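(* Let $x\in\mathbb R^d$ be maintained in a turnstile stream, with integer coordinates bounded in absolute value by $\mathrm{poly}(d)$, and let $c>0$ be a universal constant. If $\|x\|_\infty\ge c\|x\|_2$, then there is a streaming algorithm using $O(\varepsilon^{-2}\log d)$ bits of space that outputs an estimate $\mathrm{Est}$ with $\mathrm{Est}=\|x\|_\infty\pm\varepsilon\|x\|_2$ with probability at least $9/10$. The update time of the algorithm is $O(\log(1/\varepsilon))$ in the Word RAM model with word size $\Omega(\log d)$.
   Context: In a turnstile stream, $x\in\mathbb R^d$ starts at $0$ and each update $(i,v)$ sets $x_i\gets x_i+v$. *)

(* Defs.v *)
From mathcomp Require Import all_boot all_order all_algebra.
From mathcomp Require Import reals normedtype exp.

Set Implicit Arguments.
Unset Strict Implicit.
Unset Printing Implicit Defensive.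

Import Order.TTheory GRing.Theory Num.Theory.
Local Open Scope ring_scope.

Inductive binop :=
  | Add | Sub | Mul | Div | Mod | And | Or | Xor | Shl | Shr | Lt | Eq.

(* Word RAM instructions, each of unit cost. The arguments are addresses of
   memory cells, except for the constant of [Const] and the jump target of [Jz].
   There are no registers apart from the program counter, so all the working
   storage of a program is in its memory. *)
Inductive instr :=
  | Const (a v : nat)              (* M[a] := v *)
  | Op (o : binop) (a a1 a2 : nat) (* M[a] := M[a1] o M[a2] *)
  | Fetch (a a1 : nat)             (* M[a] := M[M[a1]] *)
  | Store (a a1 : nat)             (* M[M[a]] := M[a1] *)
  | Rand (a : nat)                 (* M[a] := fresh uniformly random word *)
  | Jz (a l : nat)                 (* if M[a] = 0 then goto l *)
  | Halt.

Definition program := seq instr.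

(* Arithmetic on [w]-bit words; division by zero is total as in [divn]. *)
Definition alu (w : nat) (o : binop) (x y : nat) : nat :=
  (match o with
   | Add => x + y
   | Sub => x + (2 ^ w - y)
   | Mul => x * y
   | Div => x %/ y
   | Mod => x %% y
   | And => Nat.land x y
   | Or => Nat.lor x y
   | Xor => Nat.lxor x y
   | Shl => x * 2 ^ y
   | Shr => x %/ 2 ^ y
   | Lt => x < y
   | Eq => x == y
   end %% 2 ^ w)%N.

(* The memory [M] consists of [size M] cells of [b] bits each: a write keeps the
   [b] low-order bits, so the whole memory stores exactly [size M * b] bits.
   Reads outside the memory return 0 and writes outside it have no effect. *)
Definition read (M : seq nat) (a : nat) : nat := nth 0%N M a.

Definition write (b : nat) (M : seq nat) (a v : nat) : seq nat :=
  if (a < size M)%N then set_nth 0%N M a (v %% 2 ^ b)%N else M.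

(* A memory together with the random words that have not been consumed yet; a
   random word that is needed again has to be kept in the memory. *)
Definition state := (seq nat * seq nat)%type.

(* [exec w b P n pc M rs] runs [P] on a machine with word size [w] from
   instruction [pc]. It is [Some _] iff the run halts after executing at most
   [n] instructions (without running out of random words). *)
Fixpoint exec (w b : nat) (P : program) (n pc : nat) (M rs : seq nat) :
    option state :=
  if n isn't n'.+1 then None else
  match nth Halt P pc with
  | Const a v => exec w b P n' pc.+1 (write b M a (v %% 2 ^ w)%N) rs
  | Op o a a1 a2 =>
      exec w b P n' pc.+1 (write b M a (alu w o (read M a1) (read M a2))) rs
  | Fetch a a1 => exec w b P n' pc.+1 (write b M a (read M (read M a1))) rs
  | Store a a1 => exec w b P n' pc.+1 (write b M (read M a) (read M a1)) rs
  | Rand a =>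
      if rs is r :: rs' then exec w b P n' pc.+1 (write b M a r) rs' else None
  | Jz a l => exec w b P n' (if read M a == 0%N then l else pc.+1) M rs
  | Halt => Some (M, rs)
  end.

(* Calling convention: the two arguments are placed in cells 0 and 1. *)
Definition call (w b : nat) (P : program) (n x y : nat) (st : state) :
    option state :=
  exec w b P n 0%N (write b (write b st.1 0%N x) 1%N y) st.2.

Definition stream (d : nat) := seq ('I_d * int).

Definition freq (d : nat) (s : stream d) : 'rV[int]_d :=
  \row_i \sum_(u <- s | u.1 == i) u.2.

(* The coordinates are bounded by [B] at all times, not only at the end. *)
Definition bounded_stream (d B : nat) (s : stream d) : Prop :=
  forall (t : nat) (i : 'I_d), `|freq (take t s) 0 i| <= B%:Z.

(* [mx_norm] is the max norm of a matrix. *)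
Definition linf (R : realType) (d : nat) (x : 'rV[int]_d) : R :=
  mx_norm (map_mx intr x : 'rV[R]_d).

Definition l2 (R : realType) (d : nat) (x : 'rV[int]_d) : R :=
  Num.sqrt (\sum_i (x 0 i)%:~R ^+ 2).

Record stream_alg := StreamAlg {
  init_prog : program;
  update_prog : program;
  query_prog : program }.

(* Two's complement. *)
Definition word_of_int (w : nat) (v : int) : nat :=
  `|(v %% (2 ^ w)%N%:Z)%Z|%N.

(* The accuracy is passed to the algorithm as [floor (1 / eps)], or as the
   largest value that fits in a cell if that is smaller. *)
Definition accuracy_word (R : realType) (b : nat) (eps : R) : nat :=
  minn (2 ^ b).-1%N (Num.truncn eps^-1).

Fixpoint feed (d w b T : nat) (P : program) (s : stream d) (st : state) :
    option state :=
  if s is (i, v) :: s' then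
    obind (feed w b T P s') (call w b P T i (word_of_int w v) st)
  else Some st.

(* The run of [A] on the stream [s] with [m] cells of [b] bits, initially zero,
   and with the random words [rs]. Each update may execute at most [T]
   instructions, initialization and the final query at most [n]. The estimate is
   the fraction formed by the words that the query leaves in cells 0 and 1. The
   result is [None] if one of these runs does not halt in time. *)
Definition estimate (R : realType) (A : stream_alg) (d w m b T n : nat)
    (eps : R) (s : stream d) (rs : seq nat) : option R :=
  obind (fun st0 => obind (fun st1 =>
      omap (fun st2 : state => (read st2.1 0%N)%:R / (read st2.1 1%N)%:R)
        (call w b (query_prog A) n 0%N 0%N st1))
      (feed w b T (update_prog A) s st0))
    (call w b (init_prog A) n d (accuracy_word b eps) (nseq m 0%N, rs)).

(* The random source: [N] independent uniform [w]-bit words. *)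
Definition random_words (w N : nat) := N.-tuple 'I_(2 ^ w).

Definition words_of (w N : nat) (r : random_words w N) : seq nat :=
  [seq nat_of_ord i | i <- r].

Definition prob (R : realType) (Omega : finType) (E : pred Omega) : R :=
  #|E|%:R / #|Omega|%:R.

(* Main.v *)
(* The algorithm is a single-row CountSketch whose buckets hold two counters,
   with independent signs. A pairwise independent hash splits the coordinates
   into 2^l buckets, with 2^l of order min(eps^-2, d); the estimate is the
   maximum over the buckets of the minimum of the two absolute values.
   Call a coordinate heavy if x_i^2 >= tau |x|_2^2, where tau depends only on c.
   There are at most 1/tau heavy coordinates, and by Chebyshev's inequality the
   noise in the bucket of each of them is at most eps |x|_2 for both signs. A
   bucket without heavy coordinates exceeds c |x|_2 only if both counters do, so
   the failure probability is a sum over the buckets of squared Chebyshev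
   bounds; this is of order (tau + 2^-l) / c^4. This second counter replaces the
   fourth moments, which would require 4-wise independent signs.
   For eps < d^(-1/2) the number of buckets is capped at order d, and a heavy
   coordinate is then likely to collide with no other coordinate at all, so that
   its noise is 0.
   All hash functions are of multiply-shift type, (a i + c mod 2^b) >> (b - l). *)
Require Import Defs.
From mathcomp Require Import all_boot all_order all_algebra.
From mathcomp Require Import reals normedtype exp.
From mathcomp Require Import zify ring lra.

Import Order.TTheory GRing.Theory Num.Theory.
Local Open Scope ring_scope.

Set Implicit Arguments.
Unset Strict Implicit.

(** * Machine words *)

Lemma word_of_intE b u : (word_of_int b u)%:Z = (u %% (2 ^ b)%N%:Z)%Z.
Proof. by rewrite /word_of_int gez0_abs // modz_ge0 // eqz_nat expn_eq0. Qed.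

Lemma word_of_int_lt b u : (word_of_int b u < 2 ^ b)%N.
Proof. by rewrite -ltz_nat word_of_intE ltz_pmod // ltz_nat expn_gt0. Qed.

Lemma word_of_intD b u v :
  ((word_of_int b u + word_of_int b v) %% 2 ^ b)%N = word_of_int b (u + v).
Proof.
by apply/eqP; rewrite -eqz_nat -modz_nat PoszD !word_of_intE modzDm.
Qed.

Lemma word_of_intM b u v :
  ((word_of_int b u * word_of_int b v) %% 2 ^ b)%N = word_of_int b (u * v).
Proof.
by apply/eqP; rewrite -eqz_nat -modz_nat PoszM !word_of_intE modzMm.
Qed.

Lemma word_of_int0 b : word_of_int b 0 = 0%N.
Proof. by rewrite /word_of_int mod0z. Qed.

(** Since 2^b divides 2^w, a b-bit cell that receives a w-bit two's complement argument keeps the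
    two's complement of the same integer. *)
Lemma word_of_int_mod w b u : (b <= w)%N ->
  (word_of_int w u %% 2 ^ b)%N = word_of_int b u.
Proof.
move=> bw; apply/eqP; rewrite -eqz_nat -modz_nat !word_of_intE; apply/eqP.
rewrite -{1}(subnK bw) expnD PoszM.
rewrite {2}(divz_eq u (Posz (2 ^ (w - b)) * Posz (2 ^ b))%R) mulrA.
by rewrite modzMDl.
Qed.

Lemma word_of_sign b s : (0 < b)%N -> (s < 2)%N ->
  ((1 + (2 ^ b - (s + s))) %% 2 ^ b)%N = word_of_int b (1 - (2 * s)%N%:Z).
Proof.
move=> b0 s2; apply/eqP; rewrite -eqz_nat -modz_nat word_of_intE; apply/eqP.
have h : (s + s <= 2 ^ b)%N.
  by apply: (@leq_trans (2 ^ 1)%N); [lia|rewrite leq_pexp2l].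
rewrite -(modzDr (1 - _)); congr (_ %% _)%Z; lia.
Qed.

(** Of the words of u and -u modulo 2^b, one is |u|, below 2^(b-1), and the other is 2^b - |u|,
    above it; for u = 0 both are 0. *)
Lemma abs_word b u : (`|u| < 2 ^ b.-1)%N -> (0 < b)%N ->
  minn (word_of_int b u) ((0 + (2 ^ b - word_of_int b u)) %% 2 ^ b) = `|u|%N.
Proof.
move=> ub b0.
have E : (2 ^ b = 2 * 2 ^ b.-1)%N by rewrite -expnS prednK.
have [u0|u0] := leP 0 u.
  have -> : word_of_int b u = `|u|%N.
    by apply/eqP; rewrite -eqz_nat word_of_intE modz_small; lia.
  have [->|un] := eqVneq u 0; first by rewrite min0n.
  by rewrite add0n modn_small; lia.
have -> : (word_of_int b u = 2 ^ b - `|u|)%N.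
  apply/eqP; rewrite -eqz_nat word_of_intE -modzDr modz_small; lia.
by rewrite add0n modn_small; lia.
Qed.

Section Words.
Variables (w b : nat) (bw : (b <= w)%N) (b0 : (0 < b)%N).
Implicit Types x y : nat.

Lemma modw x : ((x %% 2 ^ w) %% 2 ^ b = x %% 2 ^ b)%N.
Proof. by rewrite modn_dvdm // dvdn_exp2l. Qed.

Lemma aluAdd x y : (alu w Add x y %% 2 ^ b = (x + y) %% 2 ^ b)%N.
Proof. exact: modw. Qed.

Lemma aluMul x y : (alu w Mul x y %% 2 ^ b = (x * y) %% 2 ^ b)%N.
Proof. exact: modw. Qed.

(** The machine complements modulo 2^w, which is a multiple of 2^b, so after truncation to a cell
    this is a complement modulo 2^b. *)
Lemma aluSub x y : (y <= 2 ^ b)%N ->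
  (alu w Defs.Sub x y %% 2 ^ b = (x + (2 ^ b - y)) %% 2 ^ b)%N.
Proof.
move=> yb; rewrite /= modw.
have wE : (2 ^ w = (2 ^ (w - b)).-1 * 2 ^ b + 2 ^ b)%N.
  by rewrite -mulSnr prednK ?expn_gt0// -expnD subnK.
by rewrite wE -addnBA // addnCA modnMDl.
Qed.

Lemma aluDiv x y : (x < 2 ^ b)%N -> (alu w Div x y %% 2 ^ b = x %/ y)%N.
Proof. by move=> xb; rewrite /= modw modn_small // (leq_ltn_trans (leq_div _ _)). Qed.

Lemma aluLt x y : (alu w Lt x y %% 2 ^ b = (x < y))%N.
Proof.
rewrite /= modw modn_small //; apply: (@leq_trans (2 ^ 1)%N); last by rewrite leq_pexp2l.
by case: (x < y)%N.
Qed.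

(** Branch-free choice, by which [query] computes absolute values, minima and maxima. *)
Lemma select x y (t : bool) : (x < 2 ^ b)%N -> (y < 2 ^ b)%N ->
  ((x + ((y + (2 ^ b - x)) %% 2 ^ b * t) %% 2 ^ b) %% 2 ^ b = if t then y else x)%N.
Proof.
move=> xb yb; case: t; last by rewrite muln0 mod0n addn0 modn_small.
rewrite muln1 modn_mod modnDmr addnCA subnKC ?(ltnW xb) // modnDr modn_small //.
Qed.

(** The budget is kept as a sum: one instruction is charged to the first part while n stays symbolic
    for the runs that follow. *)
Lemma execS P k n pc M rs : exec w b P (k.+1 + n) pc M rs =
  match nth Halt P pc with
  | Const a v => exec w b P (k + n) pc.+1 (write b M a (v %% 2 ^ w)%N) rs
  | Op o a a1 a2 =>
      exec w b P (k + n) pc.+1 (write b M a (alu w o (read M a1) (read M a2))) rs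
  | Fetch a a1 => exec w b P (k + n) pc.+1 (write b M a (read M (read M a1))) rs
  | Store a a1 => exec w b P (k + n) pc.+1 (write b M (read M a) (read M a1)) rs
  | Rand a =>
      if rs is r :: rs' then exec w b P (k + n) pc.+1 (write b M a r) rs' else None
  | Jz a l => exec w b P (k + n) (if read M a == 0%N then l else pc.+1) M rs
  | Halt => Some (M, rs)
  end.
Proof. by []. Qed.

Lemma write_lt M a v : (a < size M)%N ->
  write b M a v = set_nth 0%N M a (v %% 2 ^ b)%N.
Proof. by rewrite /write => ->. Qed.

End Words.

(** * The programs *)

Arguments call : simpl never.
Arguments exec : simpl never.

(* Cells 2-7 hold the seeds of the bucket hash and of the two sign hashes, cells
   8 and 9 the divisors 2^(b - l) and 2^(b - 1) which extract the top bits of a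
   hash, cell 10 the end of the memory, and cells 11-15 are scratch. The counters
   of bucket j are in cells 16 + 2j and 16 + 2j + 1.
   The number 2^(l + 1) of counters is found by probing for the end of the memory
   at the addresses 16 + 4, 16 + 8, 16 + 16, ... *)
Definition init : program := [::
  Rand 2; Rand 3; Rand 4; Rand 5; Rand 6; Rand 7;
  Const 11 0; Const 12 1; Const 13 16; Const 14 4;
  Op Add 10 13 14; Store 10 12; Fetch 15 10; Jz 15 17;
  Store 10 11; Op Add 14 14 14; Jz 11 10;
  Op Defs.Sub 9 11 12; Const 13 2; Op Div 9 9 13; Op Add 9 9 12;
  Const 13 4; Op Div 14 14 13; Op Div 8 9 14; Halt].

Definition update : program := [::
  Op Mul 13 0 2; Op Add 13 13 3; Op Div 13 13 8;
  Op Add 13 13 13; Const 14 16; Op Add 13 14 13;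
  Op Mul 14 0 4; Op Add 14 14 5; Op Div 14 14 9;
  Op Add 14 14 14; Const 15 1; Op Defs.Sub 14 15 14; Op Mul 14 14 1;
  Fetch 15 13; Op Add 14 15 14; Store 13 14;
  Const 15 1; Op Add 13 13 15;
  Op Mul 14 0 6; Op Add 14 14 7; Op Div 14 14 9;
  Op Add 14 14 14; Op Defs.Sub 14 15 14; Op Mul 14 14 1;
  Fetch 15 13; Op Add 14 15 14; Store 13 14; Halt].

(* Modulo 2^b, the absolute value of a two's complement word x is the minimum of
   x and -x, and min(x, y) is x + (y - x) * (y < x). *)
Definition query : program := [::
  Const 11 16; Const 12 1;
  Op Lt 13 11 10; Jz 13 27;
  Fetch 13 11; Op Add 11 11 12; Fetch 14 11; Op Add 11 11 12;
  Op Defs.Sub 15 1 13;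
  Op Lt 2 15 13; Op Defs.Sub 3 15 13; Op Mul 3 3 2; Op Add 13 13 3;
  Op Defs.Sub 15 1 14;
  Op Lt 2 15 14; Op Defs.Sub 3 15 14; Op Mul 3 3 2; Op Add 14 14 3;
  Op Lt 2 14 13; Op Defs.Sub 3 14 13; Op Mul 3 3 2; Op Add 13 13 3;
  Op Lt 2 0 13; Op Defs.Sub 3 13 0; Op Mul 3 3 2; Op Add 0 0 3;
  Jz 1 2;
  Const 1 1; Halt].

Definition sketch_alg := StreamAlg init update query.

(** * The sketch as a linear function of the vector *)

Definition mshash (b l : nat) (p : nat * nat) (i : nat) : nat :=
  ((p.1 * i + p.2) %% 2 ^ b %/ 2 ^ (b - l))%N.

Definition mssign (b : nat) (p : nat * nat) (i : nat) : int :=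
  1 - (2 * mshash b 1 p i)%N%:Z.

Definition bucket_sum d (h : nat -> nat) (sg : nat -> int) (j : nat)
    (x : 'rV[int]_d) : int := \sum_(i < d | h i == j) sg i * x 0 i.

Lemma mshash_lt b l p i : (l <= b)%N -> (mshash b l p i < 2 ^ l)%N.
Proof.
move=> lb; rewrite ltn_divLR ?expn_gt0 // -expnD subnKC // ltn_mod expn_gt0 //.
Qed.

Lemma bucket_sumD d h sg j (x y : 'rV[int]_d) :
  bucket_sum h sg j (x + y) = bucket_sum h sg j x + bucket_sum h sg j y.
Proof.
by rewrite /bucket_sum -big_split; apply: eq_bigr => i _; rewrite mxE mulrDr.
Qed.

Definition single d (i : 'I_d) (v : int) : 'rV[int]_d :=
  \row_j (if i == j then v else 0).

Lemma bucket_sum_single d h sg j (i : 'I_d) v :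
  bucket_sum h sg j (single i v) = if h i == j then sg i * v else 0.
Proof.
rewrite /bucket_sum big_mkcond (bigD1 i) //= mxE eqxx big1 ?addr0 // => i' ni.
by rewrite mxE [i == i']eq_sym (negPf ni) mulr0 if_same.
Qed.

Lemma freq_cons d i v (s : stream d) : freq ((i, v) :: s) = single i v + freq s.
Proof.
apply/rowP => j; rewrite !mxE big_cons /=; case: eqP => _ //.
by rewrite add0r.
Qed.

Lemma obind_Some (T S : Type) (f : T -> option S) (t : T) : obind f (Some t) = f t.
Proof. by []. Qed.

Lemma feed_cons w b d T P (i : 'I_d) v (s : stream d) st :
  feed w b T P ((i, v) :: s) st =
  obind (feed w b T P s) (call w b P T i (word_of_int w v) st).
Proof. by []. Qed.

(** * Symbolic execution of the three programs *)

Section Runs.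
Variables (w b l : nat) (bw : (b <= w)%N) (l0 : (0 < l)%N) (lb : (l < b)%N).
Hypothesis Lb : (16 + 2 ^ l.+1 + 2 <= 2 ^ b)%N.

Let b0 : (0 < b)%N. Proof. by case: b lb. Qed.
Let b16 : (18 < 2 ^ b)%N.
Proof. by apply: leq_trans Lb; rewrite expnS; have := expn_gt0 2 l; lia. Qed.

Let modlt x : (x %% 2 ^ b < 2 ^ b)%N.
Proof. by rewrite ltn_mod expn_gt0. Qed.

Lemma nth16 v0 v1 v2 v3 v4 v5 v6 v7 v8 v9 v10 v11 v12 v13 v14 v15 cs j :
  nth 0%N [:: v0, v1, v2, v3, v4, v5, v6, v7, v8, v9, v10, v11, v12, v13, v14,
    v15 & cs] (16 + j) = nth 0%N cs j.
Proof. by []. Qed.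

Lemma write16 v0 v1 v2 v3 v4 v5 v6 v7 v8 v9 v10 v11 v12 v13 v14 v15 cs j v :
  write b [:: v0, v1, v2, v3, v4, v5, v6, v7, v8, v9, v10, v11, v12, v13, v14,
    v15 & cs] (16 + j) v =
  [:: v0, v1, v2, v3, v4, v5, v6, v7, v8, v9, v10, v11, v12, v13, v14,
    v15 & write b cs j v].
Proof. by rewrite /write (fun_if (fun c => [:: v0, v1, v2, v3, v4, v5, v6, v7,
  v8, v9, v10, v11, v12, v13, v14, v15 & c])). Qed.

Ltac fetch :=
  rewrite execS;
  match goal with |- context [nth Halt ?P ?n] =>
    let i := eval cbv in (nth Halt P n) in change (nth Halt P n) with i end;
  cbv beta iota; rewrite /read; cbn [nth].
Ltac writes := rewrite write_lt; [|by []]; cbn [set_nth].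
Ltac step := fetch; writes.

(** The shape of the memory between calls. Cells 0, 1 and 11-15 may hold anything, and the seeds
    appear modulo 2^b because cells truncate random words. *)
Definition layout (p q r : nat * nat) (v0 v1 v11 v12 v13 v14 v15 : nat)
    (cs : seq nat) : seq nat :=
  [:: v0, v1, p.1 %% 2 ^ b, p.2 %% 2 ^ b, q.1 %% 2 ^ b, q.2 %% 2 ^ b,
      r.1 %% 2 ^ b, r.2 %% 2 ^ b, 2 ^ (b - l), 2 ^ b.-1, 16 + 2 ^ l.+1,
      v11, v12, v13, v14, v15 & cs]%N.

(** [update] has no jumps: its 28 instructions, [Halt] included, are executed once each, which is
    the constant update time. *)
Lemma update_run d (i : 'I_d) (id : (d <= 2 ^ b)%N) (v : int)
    p q r (v0 v1 v11 v12 v13 v14 v15 : nat) cs rs n :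
  size cs = (2 ^ l.+1)%N ->
  let a := (mshash b l p i + mshash b l p i)%N in
  let cs1 := set_nth 0%N cs a
    ((nth 0 cs a + word_of_int b (mssign b q i * v)%R) %% 2 ^ b)%N in
  exists u0 u1 u11 u12 u13 u14 u15 : nat,
  call w b update (28 + n) i (word_of_int w v)
    (layout p q r v0 v1 v11 v12 v13 v14 v15 cs, rs)%N =
  Some (layout p q r u0 u1 u11 u12 u13 u14 u15
    (set_nth 0%N cs1 a.+1
      ((nth 0 cs1 a.+1 + word_of_int b (mssign b r i * v)%R) %% 2 ^ b)%N), rs).
Proof.
move=> scs a cs1; do 7 eexists.
have hL : (mshash b l p i < 2 ^ l)%N by rewrite mshash_lt // ltnW.
have L2 : (2 ^ l.+1 = 2 ^ l + 2 ^ l)%N by rewrite expnS mul2n addnn.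
have sE t : (((t.1 * i + t.2) %% 2 ^ b) %/ 2 ^ b.-1 = mshash b 1 t i)%N.
  by rewrite /mshash subn1.
have s2 t : (mshash b 1 t i < 2)%N by exact: mshash_lt.
have s2q := s2 q; have s2r := s2 r.
rewrite /call /layout; cbn [fst snd]; writes; writes.
rewrite (word_of_int_mod v bw) (modn_small (leq_trans (ltn_ord i) id)).
step; rewrite (aluMul bw) modnMmr.
step; rewrite (aluAdd bw) modnDmr modnDml (mulnC i).
step; rewrite (aluDiv bw) -/(mshash b l p i); [|exact: modlt].
step; rewrite (aluAdd bw) [((_ + _) %% _)%N]modn_small -/a; [|lia].
step; rewrite (modw bw) [(16 %% _)%N]modn_small; [|lia].
step; rewrite (aluAdd bw) [((_ + _) %% _)%N]modn_small; [|lia].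
step; rewrite (aluMul bw) modnMmr.
step; rewrite (aluAdd bw) modnDmr modnDml (mulnC i).
step; rewrite (aluDiv bw) ?sE; [|exact: modlt].
step; rewrite (aluAdd bw) [((_ + _) %% _)%N]modn_small; [|lia].
step; rewrite (modw bw) [(1 %% _)%N]modn_small; [|lia].
step; rewrite (aluSub bw); [|lia]; rewrite (word_of_sign b0 s2q).
step; rewrite (aluMul bw) word_of_intM -/(mssign b q i).
step; rewrite nth16.
step; rewrite (aluAdd bw) modnDml.
fetch; rewrite write16 write_lt; [|lia]; rewrite modn_mod -/cs1.
step; rewrite (modw bw) [(1 %% _)%N]modn_small; [|lia].
step; rewrite (aluAdd bw) addn1 -addnS [((_ + _) %% _)%N]modn_small; [|lia].
step; rewrite (aluMul bw) modnMmr.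
step; rewrite (aluAdd bw) modnDmr modnDml (mulnC i).
step; rewrite (aluDiv bw) ?sE; [|exact: modlt].
step; rewrite (aluAdd bw) [((_ + _) %% _)%N]modn_small; [|lia].
step; rewrite (aluSub bw); [|lia]; rewrite (word_of_sign b0 s2r).
step; rewrite (aluMul bw) word_of_intM -/(mssign b r i).
step; rewrite nth16.
step; rewrite (aluAdd bw) modnDml.
have scs1 : size cs1 = size cs by rewrite size_set_nth; apply/maxn_idPr; lia.
fetch; rewrite write16 write_lt; [|lia]; rewrite modn_mod.
by rewrite execS; cbn [nth update].
Qed.

(** One probe takes 7 instructions. While 16 + 2^j lies inside the memory, the 1 written there is
    read back and then reset to 0, so the counters remain zero and the probed offset doubles. *)
Lemma init_loop rs (v0 v1 s2 s3 s4 s5 s6 s7 v8 v9 : nat) n k : forall j (v10 v15 : nat),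
  (j + k)%N = l.+1 ->
  exists u10 u15 : nat,
  exec w b init (7 * k + n) 10
    [:: v0, v1, s2, s3, s4, s5, s6, s7, v8, v9, v10, 0, 1, 16, 2 ^ j, v15 &
        nseq (2 ^ l.+1) 0]%N rs =
  exec w b init n 10
    [:: v0, v1, s2, s3, s4, s5, s6, s7, v8, v9, u10, 0, 1, 16, 2 ^ l.+1, u15 &
        nseq (2 ^ l.+1) 0]%N rs.
Proof.
elim: k => [|k IH] j v10 v15 jk.
  by rewrite -jk addn0; exists v10, v15.
have jl : (2 ^ j.+1 <= 2 ^ l.+1)%N by rewrite leq_pexp2l // -jk addnS ltnS leq_addr.
have jS : (2 ^ j.+1 = 2 ^ j + 2 ^ j)%N by rewrite expnS mul2n addnn.
have j0 : (0 < 2 ^ j)%N by rewrite expn_gt0.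
case: (IH j.+1 (16 + 2 ^ j)%N 1%N) => [|v10' [v15' IHj]]; first by rewrite addSnnS.
exists v10', v15'; rewrite -IHj.
rewrite mulnS -addnA.
step; rewrite (aluAdd bw) [((_ + _) %% _)%N]modn_small; [|lia].
fetch; rewrite write16 write_lt ?size_nseq; [|lia].
rewrite modn_small; [|lia].
step; rewrite nth16 nth_set_nth /= eqxx modn_small; [|lia].
fetch; rewrite -[1%N == 0%N]/false; cbv beta iota.
fetch; rewrite write16 write_lt ?size_set_nth ?size_nseq; [|lia].
rewrite mod0n.
have -> : set_nth 0%N (set_nth 0%N (nseq (2 ^ l.+1) 0%N) (2 ^ j) 1%N) (2 ^ j) 0%N =
          nseq (2 ^ l.+1) 0%N.
  apply: (@eq_from_nth _ 0%N) => [|i _]; first by rewrite !size_set_nth size_nseq; lia.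
  by rewrite !nth_set_nth /= !nth_set_nth /= nth_nseq if_same; case: eqP.
step; rewrite (aluAdd bw) [((_ + _) %% _)%N]modn_small -?jS; [|lia].
fetch; rewrite eqxx; reflexivity.
Qed.

(** There are 10 instructions before the loop, l - 1 successful probes (offsets 2^2 to 2^l), 4
    instructions of the failing probe and 8 after it. *)
Lemma init_run (r0 r1 r2 r3 r4 r5 x y n : nat) rs :
  exists v0 v1 v11 v12 v13 v14 v15 : nat,
  call w b init (10 + (7 * l.-1 + (12 + n))) x y
    (nseq (16 + 2 ^ l.+1) 0%N, [:: r0, r1, r2, r3, r4, r5 & rs]) =
  Some (layout (r0, r1) (r2, r3) (r4, r5) v0 v1 v11 v12 v13 v14 v15
          (nseq (2 ^ l.+1) 0%N), rs).
Proof.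
rewrite /call; cbn [fst snd].
rewrite -[nseq _ _]/([:: 0, 0, 0, 0, 0, 0, 0, 0, 0, 0, 0, 0, 0, 0, 0, 0 & nseq (2 ^ l.+1) 0])%N.
writes; writes; do 6 step.
step; rewrite (modw bw) mod0n.
step; rewrite (modw bw) [(1 %% _)%N]modn_small; [|lia].
step; rewrite (modw bw) [(16 %% _)%N]modn_small; [|lia].
step; rewrite (modw bw) [(4 %% _)%N]modn_small; [|lia].
rewrite -[4%N]/(2 ^ 2)%N.
set s0 := (x %% 2 ^ b)%N; set s1 := (y %% 2 ^ b)%N.
have [|v10 [v15 ->]] := @init_loop rs s0 s1 (r0 %% 2 ^ b) (r1 %% 2 ^ b) (r2 %% 2 ^ b)
  (r3 %% 2 ^ b) (r4 %% 2 ^ b) (r5 %% 2 ^ b) 0 0 (12 + n) l.-1 2 0 0.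
  by lia.
have L4 : (2 ^ l.+1 = 4 * 2 ^ l.-1)%N by rewrite -(expnD 2 2); congr (2 ^ _)%N; lia.
have H2 : (2 ^ b = 2 * 2 ^ b.-1)%N by rewrite -expnS prednK.
have Hlt : (0 < 2 ^ b.-1)%N by rewrite expn_gt0.
step; rewrite (aluAdd bw) [((_ + _) %% _)%N]modn_small; [|lia].
(* The address 16 + 2^(l+1) is the first one beyond the memory: the write is lost, the read gives 0,
   and the loop is left. *)
fetch; rewrite write16 /write size_nseq ltnn.
step; rewrite nth16 nth_default ?size_nseq // mod0n.
fetch; rewrite eqxx; cbv beta iota.
(* As 2^b does not fit in a cell, 2^(b-1) is obtained as (2^b - 1) / 2 + 1. Dividing it by 2^(l+1) /
   4 then gives 2^(b-l). *)
step; rewrite (aluSub bw); [|lia]; rewrite add0n [((_ - _) %% _)%N]modn_small; [|lia].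
step; rewrite (modw bw) [(2 %% _)%N]modn_small; [|lia].
step; rewrite (aluDiv bw); [|lia].
have -> : ((2 ^ b - 1) %/ 2 = 2 ^ b.-1 - 1)%N by lia.
step; rewrite (aluAdd bw) subnK // [(2 ^ b.-1 %% _)%N]modn_small; [|lia].
step; rewrite (modw bw) [(4 %% _)%N]modn_small; [|lia].
step; rewrite (aluDiv bw); [|lia].
rewrite L4 mulKn // -L4.
step; rewrite (aluDiv bw); [|lia].
have -> : (2 ^ b.-1 %/ 2 ^ l.-1 = 2 ^ (b - l))%N.
  rewrite -expnB //; first by congr (_ ^ _)%N; lia.
  by lia.
rewrite execS; cbn [nth init].
by do 7 eexists; reflexivity.
Qed.

(** Each bucket takes 25 instructions. Cell 0 accumulates the maximum; cell 1 stays 0 and serves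
    both for negation and for the unconditional jump. The bucket seeds in cells 2 and 3 are
    overwritten as scratch. *)
Lemma query_loop (cs rs : seq nat) (u u' : nat -> int) n k :
  size cs = (2 ^ l.+1)%N ->
  (forall j, (j < 2 ^ l)%N -> [/\ nth 0%N cs (j + j) = word_of_int b (u j),
     nth 0%N cs (j + j).+1 = word_of_int b (u' j),
     (`|u j| < 2 ^ b.-1)%N & (`|u' j| < 2 ^ b.-1)%N]) ->
  let mx j := \max_(i < j) minn `|u i| `|u' i| in
  forall j (s2 s3 s4 s5 s6 s7 v8 v9 v13 v14 v15 : nat), (j + k = 2 ^ l)%N ->
  exists u2 u3 u13 u14 u15 : nat,
  exec w b query (25 * k + n) 2
    [:: mx j, 0, s2, s3, s4, s5, s6, s7, v8, v9, 16 + 2 ^ l.+1, 16 + (j + j), 1,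
        v13, v14, v15 & cs]%N rs =
  exec w b query n 2
    [:: mx (2 ^ l), 0, u2, u3, s4, s5, s6, s7, v8, v9, 16 + 2 ^ l.+1,
        16 + 2 ^ l.+1, 1, u13, u14, u15 & cs]%N rs.
Proof.
have L2 : (2 ^ l.+1 = 2 ^ l + 2 ^ l)%N by rewrite expnS mul2n addnn.
have H2 : (2 ^ b = 2 * 2 ^ b.-1)%N by rewrite -expnS prednK.
move=> scs csE mx.
have mxb j : (j <= 2 ^ l)%N -> (mx j < 2 ^ b)%N.
  move=> jl; apply: (@leq_ltn_trans (2 ^ b.-1)%N); last by lia.
  apply/bigmax_leqP => i _.
  have [|_ _ ub _] := csE i; first exact: leq_trans (ltn_ord i) jl.
  by rewrite geq_min ltnW.
elim: k => [|k IH] j s2 s3 s4 s5 s6 s7 v8 v9 v13 v14 v15 jk.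
  by rewrite -jk addn0 L2 -jk addn0; exists s2, s3, v13, v14, v15.
have jl : (j < 2 ^ l)%N by rewrite -jk addnS ltnS leq_addr.
have [cj cj' uj uj'] := csE j jl.
rewrite mulnS -addnA.
step; rewrite (aluLt bw) //.
have -> : (16 + (j + j) < 16 + 2 ^ l.+1)%N by lia.
fetch; rewrite -[_ == _]/false; cbv beta iota.
step; rewrite nth16 cj modn_small ?word_of_int_lt //.
step; rewrite (aluAdd bw) [((_ + _) %% _)%N]modn_small; [|lia].
rewrite addn1 -addnS.
step; rewrite nth16 cj' modn_small ?word_of_int_lt //.
set x := word_of_int b (u j); set x' := word_of_int b (u' j).
have xb : (x < 2 ^ b)%N by exact: word_of_int_lt.
have xb' : (x' < 2 ^ b)%N by exact: word_of_int_lt.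
have mj := mxb j (ltnW jl).
step; rewrite (aluAdd bw) [((_ + _) %% _)%N]modn_small; [|lia].
rewrite addn1 -addnS.
step; rewrite (aluSub bw); [|exact: ltnW].
set y := ((0 + (2 ^ b - x)) %% 2 ^ b)%N.
step; rewrite (aluLt bw b0).
step; rewrite (aluSub bw); [|exact: ltnW].
step; rewrite (aluMul bw).
step; rewrite (aluAdd bw) select //; [|exact: modlt].
rewrite -/(minn y x) minnC abs_word //.
step; rewrite (aluSub bw); [|exact: ltnW].
set y' := ((0 + (2 ^ b - x')) %% 2 ^ b)%N.
step; rewrite (aluLt bw b0).
step; rewrite (aluSub bw); [|exact: ltnW].
step; rewrite (aluMul bw).
step; rewrite (aluAdd bw) select //; [|exact: modlt].
rewrite -/(minn y' x') minnC abs_word //.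
have aj : (`|u j| < 2 ^ b)%N by apply: ltn_trans uj _; lia.
have aj' : (`|u' j| < 2 ^ b)%N by apply: ltn_trans uj' _; lia.
step; rewrite (aluLt bw b0).
step; rewrite (aluSub bw); [|exact: ltnW].
step; rewrite (aluMul bw).
step; rewrite (aluAdd bw) select // -/(minn `|u' j| `|u j|) minnC.
set z := minn _ _.
have zb : (z < 2 ^ b)%N by rewrite gtn_min aj.
step; rewrite (aluLt bw b0).
step; rewrite (aluSub bw); [|exact: ltnW].
step; rewrite (aluMul bw).
step; rewrite (aluAdd bw) select // -/(maxn (mx j) z).
have -> : maxn (mx j) z = mx j.+1 by rewrite /mx big_ord_recr.
fetch; rewrite eqxx; cbv beta iota.
have -> : (16 + (j + j).+2)%N = (16 + (j.+1 + j.+1))%N by lia.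
by apply: IH; rewrite addSnnS.
Qed.

Lemma query_run (cs rs : seq nat) p q r (v0 v1 v11 v12 v13 v14 v15 : nat) (u u' : nat -> int) n :
  size cs = (2 ^ l.+1)%N ->
  (forall j, (j < 2 ^ l)%N -> [/\ nth 0%N cs (j + j) = word_of_int b (u j),
     nth 0%N cs (j + j).+1 = word_of_int b (u' j),
     (`|u j| < 2 ^ b.-1)%N & (`|u' j| < 2 ^ b.-1)%N]) ->
  exists M : seq nat,
  [/\ call w b query (2 + (25 * 2 ^ l + (4 + n))) 0 0
       (layout p q r v0 v1 v11 v12 v13 v14 v15 cs, rs) = Some (M, rs),
   read M 0 = \max_(i < 2 ^ l) minn `|u i| `|u' i| & read M 1 = 1%N].
Proof.
move=> scs csE.
rewrite /call /layout; cbn [fst snd]; writes; writes; rewrite mod0n.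
step; rewrite (modw bw) [(16 %% _)%N]modn_small; [|lia].
step; rewrite (modw bw) [(1 %% _)%N]modn_small; [|lia].
have := @query_loop cs rs u u' (4 + n) (2 ^ l) scs csE 0.
rewrite big_ord0 add0n => /(_ _ _ _ _ _ _ _ _ _ _ _ (erefl _)) E.
have [s2 [s3 [s13 [s14 [s15 ->]]]]] := E (p.1 %% 2 ^ b)%N (p.2 %% 2 ^ b)%N
  (q.1 %% 2 ^ b)%N (q.2 %% 2 ^ b)%N (r.1 %% 2 ^ b)%N (r.2 %% 2 ^ b)%N
  (2 ^ (b - l))%N (2 ^ b.-1)%N v13 v14 v15.
step; rewrite (aluLt bw b0) ltnn.
fetch; rewrite eqxx; cbv beta iota.
step; rewrite (modw bw) [(1 %% _)%N]modn_small; [|lia].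
rewrite execS; cbn [nth query].
by eexists; split; first reflexivity.
Qed.

(** Counters are specified modulo 2^b only, so the relation is exactly additive under updates. Size
    bounds enter when [query] takes absolute values. *)
Definition represents d (p q r : nat * nat) (cs : seq nat) (x : 'rV[int]_d) :=
  size cs = (2 ^ l.+1)%N /\
  forall j, (j < 2 ^ l)%N ->
    nth 0%N cs (j + j) =
      word_of_int b (bucket_sum (mshash b l p) (mssign b q) j x) /\
    nth 0%N cs (j + j).+1 =
      word_of_int b (bucket_sum (mshash b l p) (mssign b r) j x).

(** By linearity an update only changes the two counters of one bucket, and the offsets 2j and 2j +
    1 of different buckets are disjoint. *)
Lemma represents_update d p q r cs (x : 'rV[int]_d) (i : 'I_d) (v : int) :
  let a := (mshash b l p i + mshash b l p i)%N in
  let cs1 := set_nth 0%N cs a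
    ((nth 0 cs a + word_of_int b (mssign b q i * v)%R) %% 2 ^ b)%N in
  let cs2 := set_nth 0%N cs1 a.+1
    ((nth 0 cs1 a.+1 + word_of_int b (mssign b r i * v)%R) %% 2 ^ b)%N in
  represents p q r cs x -> represents p q r cs2 (single i v + x).
Proof.
move=> a cs1 cs2 [scs csE].
have hL : (mshash b l p i < 2 ^ l)%N by rewrite mshash_lt // ltnW.
have L2 : (2 ^ l.+1 = 2 ^ l + 2 ^ l)%N by rewrite expnS mul2n addnn.
split; first by rewrite !size_set_nth scs; lia.
move=> j jl; have [c1 c2] := csE j jl.
rewrite !bucket_sumD !bucket_sum_single /cs2 nth_set_nth /= /cs1.
rewrite !nth_set_nth /= nth_set_nth /= /a.
have [-> | hj] := eqVneq (mshash b l p i) j.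
  rewrite !eqxx eqn_leq ltnNge leqnSn /= [((j + j).+1 == _)%N]eqn_leq ltnn.
  by rewrite leqnn c1 c2 !word_of_intD; split; congr (word_of_int _ _); rewrite addrC.
have -> : (j + j == (mshash b l p i + mshash b l p i).+1)%N = false by lia.
have -> : (j + j == (mshash b l p i + mshash b l p i))%N = false by lia.
have -> : ((j + j).+1 == (mshash b l p i + mshash b l p i).+1)%N = false by lia.
have -> : ((j + j).+1 == (mshash b l p i + mshash b l p i))%N = false by lia.
by rewrite !add0r.
Qed.

Lemma feed_run d p q r (s : stream d) (rs : seq nat) (db : (d <= 2 ^ b)%N) :
  forall (x : 'rV[int]_d) (v0 v1 v11 v12 v13 v14 v15 : nat) cs,
  represents p q r cs x ->
  exists (u0 u1 u11 u12 u13 u14 u15 : nat) ds,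
    feed w b 28 update s (layout p q r v0 v1 v11 v12 v13 v14 v15 cs, rs) =
    Some (layout p q r u0 u1 u11 u12 u13 u14 u15 ds, rs) /\
    represents p q r ds (x + freq s).
Proof.
elim: s => [|[i v] s IH] x v0 v1 v11 v12 v13 v14 v15 cs xcs.
  have -> : freq (nil : stream d) = 0 by apply/rowP => j; rewrite !mxE big_nil.
  by rewrite addr0; do 8 eexists; split; [reflexivity|].
have [u0 [u1 [u11 [u12 [u13 [u14 [u15 E]]]]]]] :=
  @update_run d i db v p q r v0 v1 v11 v12 v13 v14 v15 cs rs 0 (proj1 xcs).
rewrite addn0 in E.
rewrite freq_cons addrA [x + _]addrC.
have [z0 [z1 [z11 [z12 [z13 [z14 [z15 [ds [F G]]]]]]]]] :=
  IH _ u0 u1 u11 u12 u13 u14 u15 _ (represents_update i v xcs).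
exists z0, z1, z11, z12, z13, z14, z15, ds; split; [|exact: G].
by rewrite feed_cons E obind_Some.
Qed.

Definition sketch_value d (p q r : nat * nat) (x : 'rV[int]_d) : nat :=
  \max_(j < 2 ^ l) minn `|bucket_sum (mshash b l p) (mssign b q) j x|
                        `|bucket_sum (mshash b l p) (mssign b r) j x|.

Lemma estimate_run (R : realType) d (s : stream d) (eps : R)
    (r0 r1 r2 r3 r4 r5 : nat) (db : (d <= 2 ^ b)%N) :
  (forall sg : nat -> int, (forall i, `|sg i|%N = 1%N) ->
     forall j, (`|bucket_sum (mshash b l (r0, r1)) sg j (freq s)| < 2 ^ b.-1)%N) ->
  estimate sketch_alg w (16 + 2 ^ l.+1) b 28 (28 + (7 * l + 25 * 2 ^ l)) eps s
    [:: r0; r1; r2; r3; r4; r5] =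
  Some (sketch_value (r0, r1) (r2, r3) (r4, r5) (freq s))%:R.
Proof.
move=> small.
have sgn1 q i : `|mssign b q i|%N = 1%N.
  by rewrite /mssign; have := @mshash_lt b 1 q i b0; lia.
have fq q := small _ (sgn1 q).
rewrite /estimate /sketch_alg; cbn [init_prog update_prog query_prog].
(* The same budget serves [init] and [query]; it is split here for the former and below for the
   latter, the excess going to the symbolic remainder. *)
have -> : (28 + (7 * l + 25 * 2 ^ l) =
  10 + (7 * l.-1 + (12 + (13 + 25 * 2 ^ l))))%N by lia.
have [v0 [v1 [v11 [v12 [v13 [v14 [v15 E]]]]]]] :=
  @init_run r0 r1 r2 r3 r4 r5 d (accuracy_word b eps) (13 + 25 * 2 ^ l) [::].
rewrite E obind_Some; cbv beta.
have rep0 : represents (r0, r1) (r2, r3) (r4, r5) (nseq (2 ^ l.+1) 0%N) (0 : 'rV[int]_d).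
  split; first by rewrite size_nseq.
  move=> j jl; rewrite !nth_nseq !if_same /bucket_sum.
  by rewrite !big1 ?word_of_int0 // => i _; rewrite mxE mulr0.
have [u0 [u1 [u11 [u12 [u13 [u14 [u15 [ds [F [sds dsE]]]]]]]]]] :=
  @feed_run d _ _ _ s [::] db _ v0 v1 v11 v12 v13 v14 v15 _ rep0.
rewrite add0r in dsE.
rewrite F obind_Some; cbv beta.
have -> : (10 + (7 * l.-1 + (12 + (13 + 25 * 2 ^ l))) =
  2 + (25 * 2 ^ l + (4 + (29 + 7 * l.-1))))%N by lia.
have [|M [Q M0 M1]] := @query_run ds [::] (r0, r1) (r2, r3) (r4, r5) u0 u1 u11 u12 u13 u14 u15
  (fun j => bucket_sum (mshash b l (r0, r1)) (mssign b (r2, r3)) j (freq s))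
  (fun j => bucket_sum (mshash b l (r0, r1)) (mssign b (r4, r5)) j (freq s)) (29 + 7 * l.-1) sds.
  by move=> j jl; have [-> ->] := dsE j jl; split.
by rewrite Q /omap obind_Some; cbv beta; cbn [fst]; rewrite M0 M1 divr1.
Qed.

End Runs.

(** With the division done first, adding z 2^(b-l) to the affine form visibly adds z modulo 2^l to
    the hash. *)
Lemma mshashE b l p i : (l <= b)%N ->
  mshash b l p i = ((p.1 * i + p.2) %/ 2 ^ (b - l) %% 2 ^ l)%N.
Proof.
by move=> lb; rewrite /mshash modn_divl -expnD subnKC.
Qed.

(** * Collisions of multiply-shift hashes *)

Section Collisions.
Variables (w b l d : nat) (bw : (b <= w)%N) (lb : (l <= b)%N).
Hypothesis db : (d <= 2 ^ (b - l))%N.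

Local Notation word := 'I_(2 ^ w).

Definition word_shift (s : nat) (a : word) : word :=
  Ordinal (ltn_pmod (a + s) (expn_gt0 2 w : (0 < 2 ^ w)%N)).

Lemma word_shift_inj s : injective (word_shift s).
Proof.
move=> a a' /(congr1 val) /= /eqP; rewrite eqn_modDr !modn_small // => /eqP.
exact: val_inj.
Qed.

(* Subtracts [s * i] from the additive seed, so that the hash of [i] is unchanged
   and that of [j] moves by [s * (j - i)]. *)
Definition pair_shift (i s : nat) (p : word * word) : word * word :=
  (word_shift s p.1, word_shift (s * (2 ^ w).-1 * i) p.2).

Lemma pair_shift_inj i s : injective (pair_shift i s).
Proof.
move=> [a c] [a' c'] E; have /word_shift_inj /= -> := congr1 fst E.
by have /word_shift_inj /= -> := congr1 snd E.
Qed.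

(** An odd u is coprime to 2^l, so multiplication by u permutes the residues. *)
Lemma odd_affine_inj u y : odd u ->
  injective (fun k : 'I_(2 ^ l) => Ordinal (ltn_pmod (y + k * u) (expn_gt0 2 l : (0 < 2 ^ l)%N))).
Proof.
move=> ou k k' /(congr1 val) /= /eqP; rewrite eqn_modDl => /eqP E.
apply: val_inj => /=.
wlog kk : k k' E / (k <= k')%N.
  by move=> W; case/orP: (leq_total k k') => /W; [apply|move=> <-].
have : (2 ^ l %| k' * u - k * u)%N by rewrite -eqn_mod_dvd ?leq_mul2r ?kk ?orbT // E.
rewrite -mulnBl Gauss_dvdl; last by rewrite coprimeXl // coprime2n.
case: (posnP (k' - k)) => [|kp /(dvdn_leq kp)].
  by move/eqP; rewrite subn_eq0 => k'k _; apply/eqP; rewrite eqn_leq kk.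
by have := ltn_ord k'; lia.
Qed.

Definition collides i j (p : word * word) :=
  mshash b l (nat_of_ord p.1, nat_of_ord p.2) i ==
  mshash b l (nat_of_ord p.1, nat_of_ord p.2) j.

Lemma mshash_mod a c a' c' i :
  a * i + c = a' * i + c' %[mod 2 ^ b] -> mshash b l (a, c) i = mshash b l (a', c') i.
Proof. by rewrite /mshash /= => ->. Qed.

(** For s = k 2^(b-l-t), s (j - i) = k u 2^(b-l), so the hash of j moves by k u. The factor
    [(2 ^ w).-1] plays the part of -1 modulo 2^w. *)
Lemma collides_shift i j t u k (p : word * word) :
  (j = i + 2 ^ t * u)%N -> (t <= b - l)%N ->
  collides i j (pair_shift i (k * 2 ^ (b - l - t)) p) =
  (mshash b l (nat_of_ord p.1, nat_of_ord p.2) i ==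
    (mshash b l (nat_of_ord p.1, nat_of_ord p.2) j + k * u) %% 2 ^ l)%N.
Proof.
case: p => a c jE tb; rewrite /collides /=.
set s := (k * _)%N.
have dvd : (2 ^ b %| 2 ^ w)%N by rewrite dvdn_exp2l.
have q0 : (0 < 2 ^ w)%N by rewrite expn_gt0.
have red x z i' : (((a + x) %% 2 ^ w) * i' + (c + z) %% 2 ^ w =
    (a + x) * i' + (c + z) %[mod 2 ^ b])%N.
  rewrite -modnDm -[in LHS]modnMml !modn_dvdm // -[in RHS]modnDm.
  by rewrite -[in RHS]modnMml.
have hE i' : mshash b l ((a + s) %% 2 ^ w, (c + s * (2 ^ w).-1 * i) %% 2 ^ w)%N i' =
    mshash b l (a + s, c + s * (2 ^ w).-1 * i)%N i'.
  exact: mshash_mod.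
rewrite !hE.
have -> : mshash b l (a + s, c + s * (2 ^ w).-1 * i)%N i = mshash b l (nat_of_ord a, nat_of_ord c) i.
  apply: mshash_mod.
  have aux (x y z q : nat) : (0 < q)%N ->
      ((x + z) * i + (y + z * q.-1 * i) = z * i * q + (x * i + y))%N.
    by case: q => // q _ /=; ring.
  rewrite aux //.
  by rewrite -modnDml -modnMmr (eqP dvd) muln0 mod0n.
congr (_ == _).
have -> : mshash b l (a + s, c + s * (2 ^ w).-1 * i)%N j =
    mshash b l (nat_of_ord a, (c + k * u * 2 ^ (b - l)))%N j.
  apply: mshash_mod.
  have aux (x y e f q : nat) : (0 < q)%N ->
      ((x + k * e) * (i + f * u) + (y + k * e * q.-1 * i) =
       k * e * i * q + (x * (i + f * u) + (y + k * u * (e * f))))%N.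
    by case: q => // q _ /=; ring.
  rewrite -[in (c + k * u * _)%N](subnK tb) expnD jE aux //.
  by rewrite -modnDml -modnMmr (eqP dvd) muln0 mod0n.
rewrite !mshashE //= addnA divnDMl ?expn_gt0 //.
by rewrite modnDml.
Qed.

(* Of the 2^l shifts of a seed by multiples of 2^(b - l - t), where 2^t is the
   exact power of 2 in j - i, exactly one makes i and j collide. *)
Lemma card_collides i j : (i < d)%N -> (j < d)%N -> i != j ->
  (#|collides i j| * 2 ^ l = 2 ^ w * 2 ^ w)%N.
Proof.
move=> id jd ij.
wlog lt_ij : i j id jd ij / (i < j)%N.
  move=> W; move: (ij); rewrite neq_ltn => /orP[/W -> //|ji].
  rewrite -(W j i) 1?eq_sym //; congr (_ * _)%N; apply: eq_card => p.
  by rewrite -!topredE /= /collides eq_sym.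
have z0 : (0 < j - i)%N by rewrite subn_gt0.
have [u u2 zE] := pfactor_coprime (erefl : prime 2) z0.
set t := logn 2 (j - i) in zE.
have ou : odd u by rewrite -coprime2n.
have jE : (j = i + 2 ^ t * u)%N by rewrite mulnC -zE subnKC // ltnW.
have tb : (t <= b - l)%N.
  rewrite -(@leq_exp2l 2) // (leq_trans _ db) // (leq_trans _ (ltnW jd)) //.
  apply: (@leq_trans (j - i)); last exact: leq_subr.
  by rewrite zE leq_pmull // odd_gt0.
pose phi k := pair_shift i (k * 2 ^ (b - l - t)).
(* Double counting: each shift permutes the seeds, so 2^l copies of the count form a sum over shifts
   and seeds, whose inner sum over shifts is 1. *)
have -> : (#|collides i j| * 2 ^ l = \sum_(k < 2 ^ l) \sum_p collides i j (phi k p))%N.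
  rewrite -[X in (_ * X)%N]card_ord mulnC -sum_nat_const.
  apply: eq_bigr => k _; rewrite -sum1_card big_mkcond /=.
  rewrite (reindex_inj (@pair_shift_inj i (k * 2 ^ (b - l - t)))).
  by apply: eq_bigr => p _; rewrite -topredE /= -/(phi k p); case: (collides i j (phi k p)).
rewrite exchange_big /= -[X in (X * _)%N]card_ord -[X in (_ * X)%N]card_ord -card_prod.
rewrite -sum1_card; apply: eq_bigr => p _.
under eq_bigr do rewrite (collides_shift _ _ jE tb).
set y := mshash _ _ _ i; set y' := mshash _ _ _ j.
have y2 : (y < 2 ^ l)%N by exact: mshash_lt.
transitivity (\sum_(k < 2 ^ l) ((Ordinal y2 == k) : nat))%N.
  by rewrite [RHS](reindex_inj (@odd_affine_inj u y' ou)).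
by rewrite (bigD1 (Ordinal y2)) //= eqxx big1 ?addn0 // => k /negPf; rewrite eq_sym => ->.
Qed.
End Collisions.

(** * Analysis of the sketch *)

Section Mean.
Variable R : realType.

Definition mean (T : finType) (f : T -> R) : R := (\sum_t f t) / #|T|%:R.

Lemma eq_mean (T : finType) (f g : T -> R) : f =1 g -> mean f = mean g.
Proof. by move=> fg; rewrite /mean (eq_bigr g). Qed.

Lemma mean_sum (T I : finType) (P : pred I) (f : I -> T -> R) :
  mean (fun t => \sum_(i | P i) f i t) = \sum_(i | P i) mean (f i).
Proof. by rewrite /mean exchange_big /= mulr_suml. Qed.

Lemma meanD (T : finType) (f g : T -> R) :
  mean (fun t => f t + g t) = mean f + mean g.
Proof. by rewrite /mean big_split mulrDl. Qed.

Lemma meanZl (T : finType) (c : R) (f : T -> R) :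
  mean (fun t => c * f t) = c * mean f.
Proof. by rewrite /mean -mulr_sumr mulrA. Qed.

Lemma meanZr (T : finType) (c : R) (f : T -> R) :
  mean (fun t => f t * c) = mean f * c.
Proof. by rewrite /mean -mulr_suml mulrAC. Qed.

Lemma le_mean (T : finType) (f g : T -> R) :
  (forall t, f t <= g t) -> mean f <= mean g.
Proof. by move=> fg; rewrite /mean ler_wpM2r ?invr_ge0 // ler_sum. Qed.

Lemma mean_ge0 (T : finType) (f : T -> R) : (forall t, 0 <= f t) -> 0 <= mean f.
Proof. by move=> f0; rewrite /mean divr_ge0 // sumr_ge0. Qed.

Lemma mean_cst (T : finType) (c : R) : (0 < #|T|)%N -> mean (fun _ : T => c) = c.
Proof.
by move=> T0; rewrite /mean sumr_const -[c *+ _]mulr_natr mulfK // pnatr_eq0 -lt0n.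
Qed.

Lemma mean_pair (S T : finType) (f : S * T -> R) :
  mean f = mean (fun s => mean (fun t => f (s, t))).
Proof.
rewrite /mean -mulr_suml pair_big /= card_prod natrM invfM mulrA mulrAC.
by congr (_ / _ / _); apply: eq_bigr => -[].
Qed.

Lemma mean_reindex (S T : finType) (g : S -> T) (f : T -> R) :
  bijective g -> mean (f \o g) = mean f.
Proof.
move=> bg; rewrite /mean (bij_eq_card bg); congr (_ / _).
by rewrite [RHS](reindex g) //; exact: onW_bij.
Qed.

Lemma mean_markov (T : finType) (f : T -> R) (M : R) :
  0 < M -> (forall t, 0 <= f t) -> mean (fun t => (M < f t)%R%:R) <= mean f / M.
Proof.
move=> M0 f0; rewrite -meanZr; apply: le_mean => t.
rewrite ler_pdivlMr //; case: ltP => [/ltW|_]; first by rewrite mul1r.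
by rewrite mul0r.
Qed.

End Mean.

(** * Error bounds for pairwise independent buckets and signs *)

Section Sketch.
Variables (R : realType) (d B : nat) (A S : finType).
Variables (h : A -> 'I_d -> nat) (sg : S -> 'I_d -> R).
Hypotheses (A0 : (0 < #|A|)%N) (S0 : (0 < #|S|)%N) (B0 : (0 < B)%N).
Hypothesis hB : forall a i, (h a i < B)%N.
Hypothesis hcoll : forall i j, i != j ->
  mean (fun a => (h a i == h a j)%:R) = B%:R^-1 :> R.
Hypothesis sg_sqr : forall s i, sg s i ^+ 2 = 1.
Hypothesis sg_orth : forall i j, i != j -> mean (fun s => sg s i * sg s j) = 0.

Implicit Types (a : A) (s : S) (i j : 'I_d) (x : 'I_d -> R).

(** In the expanded square the off-diagonal terms average to 0 by [sg_orth], and the signs cancel on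
    the diagonal. *)
Lemma mean_sqr_sum (P : pred 'I_d) x :
  mean (fun s => (\sum_(i | P i) sg s i * x i) ^+ 2) = \sum_(i | P i) x i ^+ 2.
Proof.
under eq_mean do rewrite expr2 mulr_suml.
rewrite mean_sum; apply: eq_bigr => i Pi.
under eq_mean do rewrite mulr_sumr.
rewrite mean_sum (bigD1 i) //= big1 => [|j /andP[_ ji]].
  rewrite addr0 -[RHS](mean_cst _ S0); apply: eq_mean => s.
  by rewrite mulrACA -!expr2 sg_sqr mul1r.
under eq_mean do rewrite mulrACA.
by rewrite meanZr sg_orth 1?eq_sym // mul0r.
Qed.

Definition counter s a (j : nat) x := \sum_(i | h a i == j) sg s i * x i.

Definition noise s a i x :=
  \sum_(k | (k != i) && (h a k == h a i)) sg s k * x k.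

Lemma counter_noise s a i x : counter s a (h a i) x = sg s i * x i + noise s a i x.
Proof.
rewrite /counter (bigD1 i) ?eqxx //=; congr (_ + _); apply: eq_bigl => k.
by rewrite andbC.
Qed.

(** Averaging over the signs first leaves the mass that collides with i, and each other coordinate
    collides with probability 1/B. *)
Lemma mean_sqr_noise i x :
  mean (fun as_ : A * S => noise as_.2 as_.1 i x ^+ 2) <=
  (\sum_k x k ^+ 2) / B%:R.
Proof.
rewrite mean_pair /=.
under eq_mean => a.
  rewrite mean_sqr_sum big_mkcondr /=.
  under eq_bigr => k _ do rewrite -mulrb -mulr_natl.
  over.
rewrite mean_sum mulr_suml [leRHS](bigD1 i) //=.
under eq_bigr => k ki do rewrite meanZr hcoll // mulrC.
by rewrite lerDr divr_ge0 // sqr_ge0.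
Qed.

(** Two bounds are combined: Chebyshev's inequality, and a union bound over the fewer than d
    possible collisions, without which the noise is 0. *)
Lemma mean_noise_gt i x (M : R) : 0 < M ->
  mean (fun as_ : A * S => (M < noise as_.2 as_.1 i x ^+ 2)%R%:R) <=
  Num.min ((\sum_k x k ^+ 2) / M) d%:R / B%:R.
Proof.
move=> M0; rewrite minr_pMl ?invr_ge0 // le_min; apply/andP; split.
  apply: (le_trans (mean_markov M0 _)) => [t|]; first exact: sqr_ge0.
  by rewrite [leRHS]mulrAC ler_pM2r ?invr_gt0 // mean_sqr_noise.
apply: (@le_trans _ _ (mean (fun as_ : A * S =>
    \sum_(k | k != i) (h as_.1 k == h as_.1 i)%:R))).
  apply: le_mean => -[a s] /=; case: ltP => [Mn|_]; last exact: sumr_ge0.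
  have [/existsP[k /andP[ki hk]]|/existsPn nk] :=
    boolP [exists k, (k != i) && (h a k == h a i)].
    by rewrite (bigD1 k) //= hk lerDl sumr_ge0.
  have noise0 : noise s a i x = 0.
    by rewrite /noise big_pred0 // => k; exact: (negbTE (nk k)).
  by move: Mn; rewrite noise0 expr0n /= ltNge ltW.
rewrite mean_sum -[X in _ <= X%:R / _]card_ord -sumr_const mulr_suml.
rewrite [leRHS](bigD1 i) //= -[leLHS]add0r lerD //.
  by rewrite mul1r invr_ge0.
apply: ler_sum => k ki; rewrite mean_pair /= mul1r.
by under eq_mean do rewrite mean_cst //; rewrite hcoll.
Qed.

(** For a fixed hash the two counters are independent, so bucket j fails with probability at most
    (V_j / M)^2, where V_j is its mass. In the mean of the sum of V_j^2, the diagonal contributes at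
    most tau F^2 and the colliding pairs at most F^2 / B. *)
Lemma mean_counters_gt x (M tau F : R) : 0 < M -> 0 <= F -> 0 <= tau ->
  \sum_k x k ^+ 2 <= F -> (forall k, x k ^+ 2 <= tau * F) ->
  mean (fun t : A * (S * S) =>
    [exists j : 'I_B, (M < counter t.2.1 t.1 j x ^+ 2) &&
                      (M < counter t.2.2 t.1 j x ^+ 2)]%:R)
  <= (tau + B%:R^-1) * (F / M) ^+ 2.
Proof.
move=> M0 F0 tau0 xF xtau.
pose V a (j : nat) := \sum_(i | h a i == j) x i ^+ 2.
have V0 a (j : nat) : 0 <= V a j by apply: sumr_ge0 => i _; exact: sqr_ge0.
pose p a (j : nat) : R := mean (fun s => (M < counter s a j x ^+ 2)%R%:R).
have pV a (j : nat) : p a j <= V a j / M.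
  apply: (le_trans (mean_markov M0 _)) => [t|]; first exact: sqr_ge0.
  by rewrite mean_sqr_sum.
have p0 a (j : nat) : 0 <= p a j by exact: mean_ge0.
apply: (@le_trans _ _ (mean (fun a => \sum_(j < B) (V a j / M) ^+ 2))).
  rewrite mean_pair; apply: le_mean => a /=.
  apply: (@le_trans _ _ (\sum_(j < B) p a j ^+ 2)); last first.
    apply: ler_sum => j _; have pj := p0 a j; have pVj := pV a j.
    by rewrite !expr2 ler_pM.
  (* Independence of the two sign seeds turns a squared probability into the mean of a product. *)
  have -> : \sum_(j < B) p a j ^+ 2 = mean (fun ss : S * S =>
      \sum_(j < B) (M < counter ss.1 a j x ^+ 2)%R%:R *
                   (M < counter ss.2 a j x ^+ 2)%R%:R).
    rewrite mean_sum; apply: eq_bigr => j _; rewrite mean_pair /=.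
    by under [RHS]eq_mean do rewrite meanZl; rewrite meanZr expr2.
  apply: le_mean => -[s s'] /=.
  case: existsP => [[j /andP[j1 j2]]|_]; last by apply: sumr_ge0 => *; rewrite mulr_ge0.
  by rewrite (bigD1 j) //= j1 j2 mulr1 lerDl sumr_ge0 // => *; rewrite mulr_ge0.
under eq_mean => a.
  under eq_bigr do rewrite exprMn.
  rewrite -mulr_suml; over.
rewrite meanZr [(F / M) ^+ 2]exprMn [leRHS]mulrA ler_pM2r ?exprn_gt0 ?invr_gt0 //.
have VE a : \sum_(j < B) V a j ^+ 2 =
    \sum_i \sum_k (h a i == h a k)%:R * (x i ^+ 2 * x k ^+ 2).
  transitivity (\sum_(j < B) \sum_i \sum_k
      (h a i == j)%:R * (h a k == j)%:R * (x i ^+ 2 * x k ^+ 2)).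
    apply: eq_bigr => j _; rewrite expr2 /V big_mkcond mulr_suml.
    apply: eq_bigr => i _; rewrite mulr_sumr [RHS]big_mkcond /=.
    rewrite big_mkcond; apply: eq_bigr => k _.
    by case: eqP => _; case: eqP => _; rewrite ?(mul0r, mulr0, mul1r).
  rewrite exchange_big; apply: eq_bigr => i _.
  rewrite exchange_big; apply: eq_bigr => k _ /=.
  rewrite -mulr_suml; congr (_ * _).
  rewrite (bigD1 (Ordinal (hB a i))) //= eqxx mul1r eq_sym big1 ?addr0 // => j.
  by rewrite -val_eqE /= eq_sym => /negPf ->; rewrite mul0r.
under eq_mean do rewrite VE.
rewrite mean_sum.
apply: (@le_trans _ _ (\sum_i (tau * F * x i ^+ 2 + x i ^+ 2 * F / B%:R))).
  apply: ler_sum => i _; rewrite mean_sum (bigD1 i) //=; apply: lerD.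
    by under eq_mean do rewrite eqxx mul1r; rewrite mean_cst // ler_wpM2r ?sqr_ge0.
  under eq_bigr => k ki do rewrite meanZr hcoll 1?eq_sym // mulrCA.
  rewrite -mulr_sumr -mulr_sumr -[leRHS]mulrA ler_wpM2l ?sqr_ge0 //.
  rewrite [leLHS]mulrC ler_wpM2r ?invr_ge0 //.
  by apply: le_trans xF; rewrite [leRHS](bigD1 i) //= lerDr sqr_ge0.
rewrite big_split /= -mulr_sumr -2!mulr_suml mulrDl [tau * F ^+ 2]mulrA.
have tauF : 0 <= tau * F by rewrite mulr_ge0.
apply: lerD; first exact: ler_wpM2l.
by rewrite -[leLHS]mulrA [leRHS]mulrC expr2 -[leRHS]mulrA ler_wpM2r ?divr_ge0.
Qed.

Section Analysis.
Variables (x : 'I_d -> R) (c e tau m : R).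
Hypotheses (c0 : 0 < c) (e0 : 0 < e) (tau0 : 0 < tau) (tauc : tau <= c ^+ 2).
Let F := \sum_k x k ^+ 2.
Hypotheses (F0 : 0 < F) (xm : forall i, `|x i| <= m).
Hypotheses (cm : c * Num.sqrt F <= m).

Definition heavy i := tau * F <= x i ^+ 2.

Definition light i := if heavy i then 0 else x i.

Definition noisy_heavy (t : A * (S * S)) := [exists i, heavy i &&
  ((e ^+ 2 * F < noise t.2.1 t.1 i x ^+ 2) ||
   (e ^+ 2 * F < noise t.2.2 t.1 i x ^+ 2))].

Definition large_light (t : A * (S * S)) := [exists j : 'I_B,
  (c ^+ 2 * F < counter t.2.1 t.1 j light ^+ 2) &&
  (c ^+ 2 * F < counter t.2.2 t.1 j light ^+ 2)].

Lemma card_heavy : #|heavy|%:R <= tau^-1.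
Proof.
rewrite -(ler_pM2r (mulr_gt0 tau0 F0)) mulKf ?gt_eqF // mulr_natl -sumr_const.
rewrite /F [leRHS](bigID heavy) /= -[leLHS]addr0 lerD //.
  by apply: ler_sum => i.
by apply: sumr_ge0 => i _; exact: sqr_ge0.
Qed.

(** Union bound over at most 1/tau heavy coordinates and two sign seeds, with threshold e^2 F for
    the squared noise. *)
Lemma mean_noisy_heavy :
  mean (fun t => (noisy_heavy t)%:R) <=
  2 / tau * (Num.min (e ^- 2) d%:R / B%:R).
Proof.
set g := _ / B%:R.
have gE i : mean (fun as_ : A * S => (e ^+ 2 * F < noise as_.2 as_.1 i x ^+ 2)%R%:R) <= g.
  have M0 : 0 < e ^+ 2 * F by rewrite mulr_gt0 ?exprn_gt0.
  apply: le_trans (mean_noise_gt i x M0) _.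
  by rewrite invfM mulrCA mulfV ?gt_eqF // mulr1.
have g0 : 0 <= g by rewrite divr_ge0 // le_min ler0n invr_ge0 exprn_ge0 // ltW.
pose ev s a i := e ^+ 2 * F < noise s a i x ^+ 2.
apply: (@le_trans _ _ (mean (fun t : A * (S * S) =>
   \sum_(i | heavy i) ((ev t.2.1 t.1 i)%:R + (ev t.2.2 t.1 i)%:R)))).
  apply: le_mean => -[a [s s']] /=; rewrite /noisy_heavy /=.
  case: existsP => [[i /andP[hi ei]]|_]; last by apply: sumr_ge0 => *; rewrite addr_ge0.
  rewrite (bigD1 i) //= -[leLHS]addr0 lerD //; last by apply: sumr_ge0 => *; rewrite addr_ge0.
  by case/orP: ei; rewrite -/(ev _ _ _) => ->; rewrite ?lerDl ?lerDr.
rewrite mean_sum.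
apply: (@le_trans _ _ (\sum_(i | heavy i) 2 * g)).
  apply: ler_sum => i _; rewrite meanD mulrDl mul1r lerD //.
    apply: le_trans (gE i); rewrite !mean_pair; apply: le_mean => a.
    by rewrite mean_pair /=; apply: le_mean => s; rewrite mean_cst.
  apply: le_trans (gE i); rewrite !mean_pair; apply: le_mean => a.
  by rewrite mean_pair /= mean_cst.
rewrite sumr_const -[leLHS]mulr_natl [leLHS]mulrA ler_wpM2r // [leLHS]mulrC.
by rewrite ler_wpM2l // card_heavy.
Qed.

Lemma mean_large_light :
  mean (fun t => (large_light t)%:R) <= (tau + B%:R^-1) / c ^+ 4.
Proof.
have M0 : 0 < c ^+ 2 * F by rewrite mulr_gt0 ?exprn_gt0.
have lightF : \sum_k light k ^+ 2 <= F.
  by apply: ler_sum => k _; rewrite /light; case: ifP => // _; rewrite expr0n sqr_ge0.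
have lightT k : light k ^+ 2 <= tau * F.
  rewrite /light; case: ifPn; last by rewrite -ltNge => /ltW.
  by rewrite expr0n mulr_ge0 // ltW.
apply: le_trans (mean_counters_gt M0 (ltW F0) (ltW tau0) lightF lightT) _.
rewrite ler_wpM2l //; first by rewrite addr_ge0 ?invr_ge0 // ltW.
by rewrite invfM mulrCA mulfV ?gt_eqF // mulr1 exprVn -exprM.
Qed.

Lemma sqr_le_norm (u v : R) : 0 <= v -> ~~ (v ^+ 2 * F < u ^+ 2) ->
  `|u| <= v * Num.sqrt F.
Proof.
move=> v0; rewrite -leNgt -[in X in _ -> X](ger0_norm v0) => uv.
rewrite -sqrtr_sqr -(sqrtr_sqr v) -sqrtrM ?sqr_ge0 //; exact: ler_wsqrtr.
Qed.

Lemma norm_sg s i : `|sg s i| = 1.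
Proof.
by apply/eqP; rewrite -sqrp_eq1 // real_normK ?num_real // sg_sqr.
Qed.

(* A bucket that contains a heavy coordinate i is its counter up to the noise of
   i, and this holds whether or not it contains other heavy coordinates. *)
Lemma counters_le t (j : nat) : (j < B)%N -> ~~ noisy_heavy t -> ~~ large_light t ->
  Num.min `|counter t.2.1 t.1 j x| `|counter t.2.2 t.1 j x| <=
  m + e * Num.sqrt F.
Proof.
case: t => a [s s'] jB /existsPn nh /existsPn nl /=.
have [/existsP[i /andP[hi /eqP <-]]|/existsPn nhv] :=
  boolP [exists i, heavy i && (h a i == j)].
  have := nh i; rewrite hi negb_or => /andP[/= ni _].
  rewrite ge_min; apply/orP; left; rewrite counter_noise.
  apply: le_trans (ler_normD _ _) _; rewrite normrM norm_sg mul1r lerD //.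
  by apply: sqr_le_norm => //; exact: ltW.
have cl s0 : counter s0 a j x = counter s0 a j light.
  apply: eq_bigr => i hi; have := nhv i; rewrite hi andbT /light.
  by move=> /negPf ->.
apply: (@le_trans _ _ m); last by rewrite lerDl mulr_ge0 ?sqrtr_ge0 // ltW.
apply: le_trans cm; rewrite ge_min !cl.
have := nl (Ordinal jB); rewrite negb_and => /orP[] /= cj; apply/orP; [left|right];
  by apply: sqr_le_norm => //; exact: ltW.
Qed.

(** The coordinate i is heavy, since its square is at least c^2 F and tau <= c^2. Its noise is
    therefore small in both counters, which bounds their minimum from below. *)
Lemma counters_ge t i : `|x i| = m -> ~~ noisy_heavy t ->
  m - e * Num.sqrt F <=
  Num.min `|counter t.2.1 t.1 (h t.1 i) x| `|counter t.2.2 t.1 (h t.1 i) x|.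
Proof.
case: t => a [s s'] xi /existsPn nh /=.
have hi : heavy i.
  rewrite /heavy -real_normK ?num_real // xi.
  apply: (@le_trans _ _ ((c * Num.sqrt F) ^+ 2)).
    by rewrite exprMn sqr_sqrtr ?ler_wpM2r // ltW.
  have c1 : 0 <= c * Num.sqrt F by rewrite mulr_ge0 ?sqrtr_ge0 // ltW.
  by rewrite !expr2 ler_pM.
have := nh i; rewrite hi negb_or /= => /andP[n1 n2].
have key s0 : ~~ (e ^+ 2 * F < noise s0 a i x ^+ 2) ->
    m - e * Num.sqrt F <= `|counter s0 a (h a i) x|.
  move=> /(sqr_le_norm (ltW e0)) n0; rewrite counter_noise.
  rewrite lerBlDr; apply: le_trans (lerD (lexx _) n0).
  rewrite -xi -[`|x i|]mul1r -(norm_sg s0 i) -normrM.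
  by rewrite -[in leLHS](addrK (noise s0 a i x) (sg s0 i * x i)) ler_normB.
by rewrite le_min !key.
Qed.

End Analysis.

End Sketch.

(** * The sketch with multiply-shift seeds *)

Section Norms.
Variables (R : realType) (d : nat) (x : 'rV[int]_d).

Lemma norm_le_linf i : `|(x 0 i)%:~R| <= linf R x.
Proof.
rewrite /linf mx_normrE.
have := @le_bigmax _ R _ 0 (fun ij : 'I_1 * 'I_d => `|(map_mx intr x : 'rV[R]_d) ij.1 ij.2|) (0, i).
by rewrite /= mxE.
Qed.

Lemma linf_attained : linf R x != 0 -> exists i, `|(x 0 i)%:~R| = linf R x.
Proof.
by move=> /mx_norm_neq0[[o i] /= E]; exists i; rewrite /linf E mxE ord1.
Qed.

(** This excludes overflow: final counters of this size are determined by their b-bit words. *)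
Lemma bucket_sum_norm B (h : nat -> nat) sg j : (forall i, `|sg i|%N = 1%N) ->
  (forall i, `|x 0 i| <= B%:Z) -> (`|bucket_sum h sg j x| <= d * B)%N.
Proof.
move=> sg1 xB; rewrite -lez_nat abszE /bucket_sum.
apply: le_trans (ler_norm_sum _ _ _) _.
rewrite PoszM -[X in _ <= X%:Z * _]card_ord.
apply: (@le_trans _ _ (\sum_(i < d | h i == j) B%:Z)).
  by apply: ler_sum => i _; rewrite normrM -abszE sg1 mul1r.
rewrite big_mkcond /= -[X in _ <= X]mulrC.
apply: (@le_trans _ _ (\sum_(i < d) B%:Z)); first by apply: ler_sum => i _; case: ifP.
by rewrite sumr_const -mulr_natr natz.
Qed.

End Norms.

Section Seeds.
Variables (R : realType) (w b l d : nat).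
Hypotheses (bw : (b <= w)%N) (lb : (l <= b)%N).
Local Notation word := 'I_(2 ^ w).

Definition seed (p : word * word) : nat * nat := (nat_of_ord p.1, nat_of_ord p.2).

Definition seed_hash (p : word * word) (i : 'I_d) : nat := mshash b l (seed p) i.

Definition seed_sign (p : word * word) (i : 'I_d) : R :=
  (mssign b (seed p) i)%:~R.

Lemma card_seed_gt0 : (0 < #|{: word * word}|)%N.
Proof. by rewrite card_prod card_ord muln_gt0 expn_gt0. Qed.

Lemma mean_collides : (d <= 2 ^ (b - l))%N -> forall i j : 'I_d, i != j ->
  mean (fun p => (seed_hash p i == seed_hash p j)%:R) = (2 ^ l)%:R^-1 :> R.
Proof.
move=> db i j ij; rewrite /mean.
have cE := card_collides bw lb db (ltn_ord i) (ltn_ord j) ij.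
have l0 : (2 ^ l)%:R != 0 :> R by rewrite pnatr_eq0 expn_eq0.
have w0 : (2 ^ w * 2 ^ w)%:R != 0 :> R by rewrite pnatr_eq0 muln_eq0 expn_eq0.
have -> : \sum_(p : word * word) (seed_hash p i == seed_hash p j)%:R = #|@collides w b l i j|%:R :> R.
  rewrite -sum1_card natr_sum [RHS]big_mkcond /=; apply: eq_bigr => p _.
  by rewrite -topredE /= /collides /seed_hash; case: (_ == _).
rewrite card_prod card_ord -cE natrM invfM mulrA mulfV ?mul1r //.
by apply: contraNneq w0 => c0; rewrite -cE natrM c0 mul0r.
Qed.

End Seeds.

Section SignSeeds.
Variables (R : realType) (w b d : nat).
Hypotheses (bw : (b <= w)%N) (b0 : (0 < b)%N).
Local Notation word := 'I_(2 ^ w).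

Lemma seed_sign_sqr (p : word * word) (i : 'I_d) : seed_sign R b p i ^+ 2 = 1 :> R.
Proof.
rewrite /seed_sign -rmorphXn /= /mssign.
have := @mshash_lt b 1 (@seed w p) i b0; by case: (mshash _ _ _ _) => [|[|n]].
Qed.

(** A sign is a one-bit hash, so a product of two signs is 2 [collision] - 1, and one-bit hashes
    collide with probability 1/2. *)
Lemma mean_sign : (d <= 2 ^ (b - 1))%N -> forall i j : 'I_d, i != j ->
  mean (fun p : word * word => seed_sign R b p i * seed_sign R b p j) = 0 :> R.
Proof.
move=> db i j ij.
have E (p : word * word) : seed_sign R b p i * seed_sign R b p j =
    2 * (seed_hash b 1 p i == seed_hash b 1 p j)%:R - 1.
  rewrite /seed_sign -intrM /seed_hash /mssign.
  have := @mshash_lt b 1 (seed p) i b0; have := @mshash_lt b 1 (seed p) j b0.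
  by case: (mshash _ _ _ i) => [|[|n]] //; case: (mshash _ _ _ j) => [|[|n']] // _ _ /=; lra.
rewrite (eq_mean E) meanD mean_cst ?card_seed_gt0 // meanZl mean_collides //.
by rewrite expn1 mulfV ?subrr // pnatr_eq0.
Qed.

(** The words are listed in the order in which [init] draws them: bucket hash first, then the two
    sign hashes. *)
Definition six_words (t : (word * word) * ((word * word) * (word * word))) :
    random_words w 6 :=
  [tuple t.1.1; t.1.2; t.2.1.1; t.2.1.2; t.2.2.1; t.2.2.2].

Lemma six_words_bij : bijective six_words.
Proof.
exists (fun r => ((tnth r 0, tnth r 1), ((tnth r 2, tnth r 3), (tnth r 4, tnth r 5)))).
  by move=> [[a c] [[a' c'] [a'' c'']]].
case=> -[|a [|c [|a' [|c' [|a'' [|c'' [|//]]]]]]] //= sz; apply: val_inj => /=.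
by rewrite !(tnth_nth a).
Qed.

Lemma prob_six_words (E : pred (random_words w 6)) :
  prob R E = mean (fun t => (E (six_words t))%:R).
Proof.
transitivity (mean (fun r : random_words w 6 => (E r)%:R : R)); last first.
  by rewrite -(mean_reindex _ six_words_bij).
rewrite /prob /mean -sum1_card natr_sum [in LHS]big_mkcond /=; congr (_ / _).
by apply: eq_bigr => r _; rewrite -topredE /=; case: (E r).
Qed.

End SignSeeds.

Section Accuracy.
Variables (R : realType) (w b l d : nat).
Hypotheses (bw : (b <= w)%N) (l0 : (0 < l)%N) (lb : (l < b)%N).
Hypothesis db : (d <= 2 ^ (b - l))%N.
Local Notation word := 'I_(2 ^ w).
Variable x : 'rV[int]_d.
Let xr (i : 'I_d) : R := (x 0 i)%:~R.

Lemma counter_bucket_sum (p q : word * word) (j : nat) :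
  counter (@seed_hash w b l d) (@seed_sign R w b d) q p j xr =
  (bucket_sum (mshash b l (seed p)) (mssign b (seed q)) j x)%:~R.
Proof. by rewrite /bucket_sum rmorph_sum; apply: eq_bigr => i _; rewrite rmorphM. Qed.

Lemma minn_norm (u v : int) :
  (minn `|u| `|v|)%:R = Num.min `|u%:~R| `|v%:~R| :> R.
Proof. by rewrite -minEnat natr_min !natr_absz !intr_norm. Qed.

Definition accurate (e : R) (t : (word * word) * ((word * word) * (word * word))) :=
  `|(sketch_value b l (seed t.1) (seed t.2.1) (seed t.2.2) x)%:R - linf R x| <=
    e * l2 R x.

Lemma accurate0 e t : l2 R x = 0 -> accurate e t.
Proof.
move=> x0; rewrite /accurate x0 mulr0.
have F0 : \sum_i xr i ^+ 2 = 0.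
  apply/eqP; rewrite eq_le sumr_ge0 ?andbT => [|i _]; last exact: sqr_ge0.
  by rewrite -sqrtr_eq0; apply/eqP.
have xi i : x 0 i = 0.
  have /psumr_eq0P := F0 => /(_ (fun i _ => sqr_ge0 _) i isT) /eqP.
  by rewrite sqrf_eq0 intr_eq0 => /eqP.
have -> : linf R x = 0.
  apply/eqP/negPn/negP => nz; have [i] := linf_attained nz.
  by rewrite xi normr0 => z; rewrite -z eqxx in nz.
rewrite /sketch_value big1 ?subrr ?normr0 // => j _.
by rewrite /bucket_sum !big1 // => i _; rewrite xi mulr0.
Qed.

(** The upper bound holds in every bucket, hence for the maximum; the lower bound comes from the
    bucket of a coordinate of maximal absolute value. *)
Lemma accurate_of t (c e tau : R) :
  0 < c -> 0 < e -> 0 < tau -> tau <= c ^+ 2 -> c * l2 R x <= linf R x ->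
  0 < \sum_i xr i ^+ 2 ->
  ~~ noisy_heavy (@seed_hash w b l d) (@seed_sign R w b d) xr e tau t ->
  ~~ large_light (2 ^ l) (@seed_hash w b l d) (@seed_sign R w b d) xr c tau t ->
  accurate e t.
Proof.
move=> c0 e0 tau0 tauc cm F0 nh nl.
have b0 : (0 < b)%N by exact: leq_trans lb.
have cm' : c * Num.sqrt (\sum_i xr i ^+ 2) <= linf R x by [].
have sq := @seed_sign_sqr R w b d b0.
have xm := @norm_le_linf R d x.
have up (j : 'I_(2 ^ l)) := counters_le sq c0 e0 xm cm' (ltn_ord j) nh nl.
have linf0 : linf R x != 0.
  by apply/negP => /eqP z; move: cm'; rewrite z leNgt mulr_gt0 // sqrtr_gt0.
have [i xi] := linf_attained linf0.
have lo := counters_ge sq c0 e0 tauc F0 cm' xi nh.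
pose f (j : 'I_(2 ^ l)) :=
  minn `|bucket_sum (mshash b l (seed t.1)) (mssign b (seed t.2.1)) j x|
       `|bucket_sum (mshash b l (seed t.1)) (mssign b (seed t.2.2)) j x|.
rewrite /accurate ler_distl; apply/andP; split.
  apply: le_trans lo _; rewrite !counter_bucket_sum -minn_norm ler_nat.
  have jl : (mshash b l (seed t.1) i < 2 ^ l)%N by rewrite mshash_lt // ltnW.
  exact: (@leq_bigmax _ f (Ordinal jl)).
have card0 : (0 < #|'I_(2 ^ l)|)%N by rewrite card_ord expn_gt0.
have -> : sketch_value b l (seed t.1) (seed t.2.1) (seed t.2.2) x = \max_j f j by [].
have [j ->] := bigop.eq_bigmax f card0.
by rewrite /f minn_norm -!counter_bucket_sum; exact: up.
Qed.

Lemma mean_accurate (c e tau : R) :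
  0 < c -> 0 < e -> 0 < tau -> tau <= c ^+ 2 -> c * l2 R x <= linf R x ->
  1 - (2 / tau * (Num.min (e ^- 2) d%:R / (2 ^ l)%:R) +
       (tau + (2 ^ l)%:R^-1) / c ^+ 4) <=
  mean (fun t => (accurate e t)%:R).
Proof.
move=> c0 e0 tau0 tauc cm.
have S0 := card_seed_gt0 w.
have T0 : (0 < #|{: (word * word) * ((word * word) * (word * word))}|)%N.
  by rewrite !card_prod !muln_gt0 !card_ord expn_gt0.
have b0 : (0 < b)%N by exact: leq_trans lb.
(* All thresholds are multiples of F, so the zero vector is treated apart; the sketch is exact on
   it. *)
have [F0|F0] := ltP 0 (\sum_i xr i ^+ 2); last first.
  have l20 : l2 R x = 0 by apply/eqP; rewrite sqrtr_eq0.
  rewrite (eq_mean (g := fun _ => 1)) => [|t]; last by rewrite accurate0.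
  rewrite mean_cst // gerBl addr_ge0 // ?mulr_ge0 ?invr_ge0 ?(ltW tau0) //.
  - by rewrite le_min invr_ge0 exprn_ge0 ?ler0n // ltW.
  - by rewrite addr_ge0 ?invr_ge0 // ltW.
  - by rewrite exprn_ge0 // ltW.
have sq := @seed_sign_sqr R w b d b0.
have hc := @mean_collides R w b l d bw (ltnW lb) db.
have db1 : (d <= 2 ^ (b - 1))%N.
  by apply: leq_trans db _; rewrite leq_pexp2l // leq_sub2l.
have orth := @mean_sign R w b d bw b0 db1.
have hB (p : word * word) (i : 'I_d) : (seed_hash b l p i < 2 ^ l)%N.
  by rewrite mshash_lt // ltnW.
have m1 := mean_noisy_heavy S0 hc sq orth e0 tau0 F0.
have m2 := mean_large_light S0 S0 hB hc sq orth c0 tau0 F0.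
apply: (@le_trans _ _ (mean (fun t => 1 +
   -1 * ((noisy_heavy (@seed_hash w b l d) (@seed_sign R w b d) xr e tau t)%:R +
   (large_light (2 ^ l) (@seed_hash w b l d) (@seed_sign R w b d) xr c tau t)%:R)))).
  by rewrite meanD mean_cst // meanZl meanD mulN1r lerD2l lerN2 lerD.
apply: le_mean => t.
have := @accurate_of t c e tau c0 e0 tau0 tauc cm F0.
have acc0 : 0 <= (accurate e t)%:R :> R by exact: ler0n.
case: noisy_heavy; case: large_light => /= acc; try lra.
by rewrite acc //=; lra.
Qed.

End Accuracy.

(** * Choice of the parameters *)

Lemma exists_pow2_ge (R : realType) (r : R) : exists n, r <= (2 ^ n)%:R.
Proof.
exists (Num.truncn r).+1.
have [r0|/ltW r0] := leP 0 r; last exact: le_trans r0 (ler0n _ _).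
apply: (le_trans (ltW (truncnS_gt r))).
by rewrite ler_nat ltnW // ltn_expl.
Qed.

Lemma exists_pow2_close (R : realType) (r : R) : 1 <= r ->
  exists n, r <= (2 ^ n)%:R <= 2 * r.
Proof.
move=> r1; have [n rn nmin] := ex_minnP (exists_pow2_ge r).
exists n; rewrite rn /=; case: n rn nmin => [|n] _ nmin.
  by rewrite expn0; lra.
rewrite expnS natrM ler_pM2l // leNgt; apply/negP => /ltW /nmin.
by rewrite ltnn.
Qed.

(** The bound d^2 makes n at most 2 log2 d, hence O(log d). *)
Lemma ltn_pow2_log (d : nat) : (1 < d)%N ->
  exists2 n, (d < 2 ^ n)%N & (2 ^ n <= d * d)%N.
Proof.
move=> d1; exists (trunc_log 2 d).+1; first exact: trunc_log_ltn.
rewrite expnS leq_mul //; apply: trunc_logP => //; exact: ltnW.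
Qed.

(** Of the bits of b, n + 1 + e pay for l; the remaining ones still exceed e, so they can index d
    coordinates. Counters up to d^(k+1) need (k + 1) e bits, and the 10 absorbs the constants. *)
Lemma word_size_bounds (d k n l e : nat) :
  (d < 2 ^ e)%N -> (0 < e)%N -> (l <= n + 1 + e)%N ->
  let b := (n + (k + 2) * e + 10)%N in
  [/\ (l < b)%N, (d <= 2 ^ (b - l))%N, (16 + 2 ^ l.+1 + 2 <= 2 ^ b)%N,
      (d * d ^ k < 2 ^ b.-1)%N & (d <= 2 ^ b)%N].
Proof.
move=> de e0 le b.
have ke : (2 * e <= (k + 2) * e)%N by rewrite leq_mul2r leq_addl orbT.
have lb : (l < b)%N by rewrite /b; lia.
have db : (d <= 2 ^ (b - l))%N.
  by apply: leq_trans (ltnW de) _; rewrite leq_pexp2l // /b; lia.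
split=> //.
- have h1 : (2 ^ l.+1 <= 2 ^ b.-1)%N by rewrite leq_pexp2l // /b; lia.
  have h2 : (32 <= 2 ^ b.-1)%N.
    by apply: (@leq_trans (2 ^ 5)) => //; rewrite leq_pexp2l // /b; lia.
  have -> : (2 ^ b = 2 * 2 ^ b.-1)%N by rewrite -expnS prednK // /b; lia.
  by move: h1 h2; move: (2 ^ _)%N (2 ^ _)%N; clear; lia.
- rewrite -expnS; apply: (@leq_trans (2 ^ (e * k.+1))).
    by rewrite expnM ltn_exp2r.
  by rewrite leq_pexp2l // /b; nia.
- by apply: leq_trans db _; rewrite leq_pexp2l // leq_subr.
Qed.

Lemma estimate_words (R : realType) (w b l d : nat) (s : stream d) (eps : R)
    (t : ('I_(2 ^ w) * 'I_(2 ^ w)) *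
         (('I_(2 ^ w) * 'I_(2 ^ w)) * ('I_(2 ^ w) * 'I_(2 ^ w)))) B :
  (b <= w)%N -> (0 < l)%N -> (l < b)%N -> (16 + 2 ^ l.+1 + 2 <= 2 ^ b)%N ->
  (d <= 2 ^ b)%N -> (d * B < 2 ^ b.-1)%N -> bounded_stream B s ->
  estimate sketch_alg w (16 + 2 ^ l.+1) b 28 (28 + (7 * l + 25 * 2 ^ l)) eps s
    (words_of (six_words t)) =
  Some (sketch_value b l (seed t.1) (seed t.2.1) (seed t.2.2) (freq s))%:R.
Proof.
case: t => [[a c] [[a' c'] [a'' c'']]] bw l0 lb Lb db dB sB.
apply: estimate_run => // sg sg1 j.
apply: leq_ltn_trans dB; apply: bucket_sum_norm => // i.
by have := sB (size s) i; rewrite take_size.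
Qed.

Unset Implicit Arguments.

Theorem theorem8p6 (R : realType) (c : R) (hc : 0 < c) (k : nat) :
  exists (K : R) (A : stream_alg),
  forall (d w : nat) (eps : R),
    (2 <= d)%N -> 0 < eps < 1 -> K * ln d%:R <= w%:R ->
  exists m b T n : nat,
    [/\ (b <= w)%N,
        (m * b)%N%:R <= K * eps ^- 2 * ln d%:R,
        T%:R <= K * (1 + ln eps^-1)
      & forall s : stream d, bounded_stream (d ^ k) s ->
        exists N : nat,
          (forall r : random_words w N,
             exists Est : R,
               estimate A w m b T n eps s (words_of r) = Some Est) /\
          (linf R (freq s) >= c * l2 R (freq s) ->
           prob R [pred r : random_words w N |
             if estimate A w m b T n eps s (words_of r) is Some Est
             then `|Est - linf R (freq s)| <= eps * l2 R (freq s)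
             else false] >= 9%:R / 10%:R)].
Proof.
(* Lowering c to at most 1 keeps the hypothesis on the norms and gives c1^4 <= c1^2, hence tau <=
   c1^2. *)
pose c1 := Num.min c 1.
have c1c : c1 <= c by rewrite ge_min lexx.
have c11 : c1 <= 1 by rewrite ge_min lexx orbT.
have c10 : 0 < c1 by rewrite lt_min hc ltr01.
pose tau := c1 ^+ 4 / 40.
have tau0 : 0 < tau by rewrite divr_gt0 ?exprn_gt0.
have tauc : tau <= c1 ^+ 2.
  rewrite /tau (exprD c1 2 2) -mulrA ger_pMr ?exprn_gt0 //.
  by have : c1 ^+ 2 <= 1 by [rewrite exprn_ile1 // ltW]; lra.
(* With at least C G buckets, the three failure terms are at most 2/100 (noisy heavy coordinates),
   1/40 (from tau) and 1/4000 (from 2^-l), together below 1/10. *)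
pose C := 100 / tau.
have Cp : 0 < C by rewrite divr_gt0.
have C4 : 4000 <= C * c1 ^+ 4.
  by rewrite /C /tau invf_div [100 * _]mulrA divfK ?gt_eqF ?exprn_gt0 //; lra.
have C1 : 4000 <= C.
  by apply: le_trans C4 _; rewrite ger_pMr // exprn_ile1 // ltW.
have [C0 CC0] := exists_pow2_ge C.
have ln20 : 0 < ln (2 : R) by rewrite ln_gt0 // ltr1n.
(* As e >= 1, the cell size b = C0 + (k + 2) e + 10 is at most (C0 + k + 12) e, and e <= 2 ln d / ln
   2. *)
pose K1 := (C0 + k + 12)%:R * (2 / ln 2) : R.
have K10 : 0 <= K1 by rewrite mulr_ge0 // divr_ge0 // ltW.
(* The summands pay respectively for the update time, for b <= w, and for the space: at most (16 + 4
   C) eps^-2 cells of K1 ln d bits. *)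
pose K := 28 + K1 + (16 + 4 * C) * K1.
have CK0 : 0 <= (16 + 4 * C) * K1 by rewrite mulr_ge0 // addr_ge0 // mulr_ge0 // ltW.
have K28 : 28 <= K by rewrite /K -addrA lerDl addr_ge0.
have K1K : K1 <= K by rewrite /K addrAC lerDr addr_ge0.
have KC : (16 + 4 * C) * K1 <= K by rewrite /K lerDr addr_ge0.
exists K, sketch_alg => d w eps d2 /andP[eps0 eps1] Kw.
have lnd : 0 <= ln (d%:R : R) by rewrite ln_ge0 // ler1n ltnW.
have e1 : 1 <= eps ^- 2 by rewrite invf_ge1 ?exprn_gt0 // exprn_ile1 // ltW.
pose G := Num.min (eps ^- 2) d%:R.
have G1 : 1 <= G by rewrite le_min e1 ler1n ltnW.
have CCG : C <= C * G by rewrite ler_peMr // ltW.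
have CG1 : 1 <= C * G by apply: le_trans CCG; apply: le_trans C1; rewrite ler1n.
(* The lower bound on 2^l serves the accuracy, the upper bound the space. *)
have [l /andP[lG Gl]] := exists_pow2_close CG1.
have [e de ed] := ltn_pow2_log d2.
have e0 : (0 < e)%N by case: e de {ed} => //; rewrite expn0 ltnS leqNgt ltnW.
have l0 : (0 < l)%N.
  case: l lG {Gl} => //; rewrite expn0 => CG2.
  by have := le_trans C1 (le_trans CCG CG2); rewrite ler_nat.
have le : (l <= C0 + 1 + e)%N.
  rewrite -(@leq_exp2l 2) // -(ler_nat R) (le_trans Gl) // !expnD expn1 !natrM.
  have Gd : G <= (2 ^ e)%:R.
    by apply: (@le_trans _ _ d%:R); [rewrite ge_min lexx orbT|rewrite ler_nat ltnW].
  rewrite [X in _ <= X * _]mulrC -[leRHS]mulrA ler_pM2l // ler_pM //; first exact: ltW.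
  exact: le_trans G1.
pose b := (C0 + (k + 2) * e + 10)%N.
have [lb db Lb dB db'] := word_size_bounds k de e0 le.
have bK : b%:R <= K1 * ln (d%:R : R).
  have eln : e%:R <= 2 / ln 2 * ln (d%:R : R).
    have d0 : 0 < d%:R :> R by rewrite ltr0n (ltnW d2).
    rewrite mulrAC ler_pdivlMr // !mulr_natl [ln _ *+ 2]mulr2n -lnM ?posrE // -lnXn //.
    rewrite -natrX -natrM ler_ln ?posrE ?ler_nat ?ltr0n ?expn_gt0 //.
    by rewrite muln_gt0 (ltnW d2).
  rewrite /K1 -mulrA (@le_trans _ _ ((C0 + k + 12)%:R * e%:R)) //; last first.
    by rewrite ler_pM2l // ltr0n addnS.
  by rewrite -natrM ler_nat /b; move: e0; clear; nia.
have bw : (b <= w)%N.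
  rewrite -(ler_nat R) (le_trans bK) // (le_trans _ Kw) // ler_wpM2r //.
exists (16 + 2 ^ l.+1)%N, b, 28%N, (28 + (7 * l + 25 * 2 ^ l))%N; split=> //.
- have cells : (16 + 2 ^ l.+1)%N%:R <= (16 + 4 * C) * eps ^- 2.
    rewrite natrD expnS natrM [leRHS]mulrDl lerD //; first by rewrite ler_peMr.
    apply: (@le_trans _ _ (2 * (2 * (C * G)))); first by rewrite ler_pM2l.
    have -> : 2 * (2 * (C * G)) = 4 * C * G by ring.
    by rewrite ler_wpM2l ?ge_min ?lexx // mulr_ge0 // ltW.
  rewrite natrM; apply: (@le_trans _ _ ((16 + 4 * C) * eps ^- 2 * (K1 * ln d%:R))).
    by rewrite ler_pM.
  by rewrite mulrA ler_wpM2r // mulrAC ler_wpM2r // ltW // (lt_le_trans ltr01).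
- have le0 : 0 <= ln eps^-1 by rewrite ln_ge0 // invf_ge1 // ltW.
  by apply: (le_trans K28); rewrite ler_peMr ?lerDl // (le_trans _ K28).
move=> s sB; exists 6%N.
have run t := estimate_words eps t bw l0 lb Lb db' dB sB.
split=> [r|lc].
  have [g _ gK] := six_words_bij w.
  by rewrite -(gK r) run; eexists.
have lc1 : c1 * l2 R (freq s) <= linf R (freq s).
  by apply: le_trans lc; rewrite ler_wpM2r ?sqrtr_ge0.
rewrite prob_six_words.
have := mean_accurate bw l0 lb db c10 eps0 tau0 tauc lc1.
set err := (X in 1 - X <= _) => accE.
have errE : err <= 1 / 10.
  rewrite /err -/G.
  have l2 : 0 < (2 ^ l)%:R :> R by rewrite ltr0n expn_gt0.
  have h1 : 2 / tau * (G / (2 ^ l)%:R) <= 2 / 100.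
    have p2 : 0 <= 2 / 100 :> R by rewrite divr_ge0.
    rewrite mulrA ler_pdivrMr // (le_trans _ (ler_wpM2l p2 lG)) //.
    by rewrite le_eqVlt /C (_ : 2 / tau * G = 2 / 100 * (100 / tau * G)) ?eqxx //; field; rewrite gt_eqF.
  have h2 : tau / c1 ^+ 4 = 1 / 40.
    by rewrite /tau mulrAC mulfV ?gt_eqF ?exprn_gt0.
  have h3 : (2 ^ l)%:R^-1 / c1 ^+ 4 <= 1 / 4000.
    have pc : 0 < (2 ^ l)%:R * c1 ^+ 4 by rewrite mulr_gt0 ?exprn_gt0.
    rewrite -invfM mul1r lef_pV2 ?posrE //.
    apply: le_trans C4 _; rewrite ler_pM2r ?exprn_gt0 //.
    exact: le_trans CCG lG.
  by rewrite [(tau + _) / _]mulrDl h2; move: h1 h3; clear; lra.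
apply: (@le_trans _ _ (1 - err)); first by move: errE; clear; lra.
apply: (le_trans accE); apply: le_mean => t.
by rewrite inE run.
Qed.
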